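(* Let $k$ be a field of characteristic $0$. There are nilpotent endomorphisms in $\underline{\mathrm{Perm}}_k(G;\nu)$ with non-zero trace; in fact, the object $\mathrm{Vec}_{Y(3)}$ has a nilpotent endomorphism with non-zero trace. Consequently, $\underline{\mathrm{Perm}}_k(G;\nu)$ cannot be embedded into any pre-Tannakian category, i.e., there is no faithful $k$-linear symmetric monoidal functor from $\underline{\mathrm{Perm}}_k(G;\nu)$ to a pre-Tannakian category over $k$.
   Context: **The group.** Let $\mathfrak{X}$ be a Cantor space (homeomorphic to the Cantor set) and $G$ the group of all self-homeomorphisms of $\mathfrak{X}$. For $\mathfrak{A} \subset \mathfrak{X}$ let $G\{\mathfrak{A}\}=\{g \in G : g\mathfrak{A}=\mathfrak{A}\}$. Topologize $G$ by taking as neighborhood basis of the identity the collection of all finite intersections $G\{\mathfrak{A}_1\} \cap \cdots \cap G\{\mathfrak{A}_n\}$ with $\mathfrak{A}_i$ clopen. A ''$G$-set'' is a set with a $G$-action all of whose point stabilizers are open; it is finitary if it has finitely many orbits. $\mathbf{S}(G)$ is the category of finitary $G$-sets; $\mathbf{1}$ is the one-point $G$-set. For $n \ge 1$, $X(n)$ (resp. $Y(n)$) is the $G$-set of surjective continuous (resp. all continuous) maps $\mathfrak{X} \to \{1,\ldots,n\}$ (discrete target). **The measure.** A measure for $G$ valued in a commutative ring $R$ is a rule $\nu$ assigning to each map $f\colon X \to Y$ in $\mathbf{S}(G)$, $Y$ transitive, some $\nu(f) \in R$ such that: (a) $\nu(f)=1$ if $f$ is an isomorphism; (b) $\nu(f)=\nu(f|_{X_1})+\nu(f|_{X_2})$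 if $X=X_1 \amalg X_2$ as $G$-sets; (c) $\nu(g \circ f)=\nu(g)\nu(f)$ for $g \colon Y \to Z$ a map of transitive $G$-sets; (d) $\nu(f')=\nu(f)$ if $f'$ is the base change of $f$ along a map $Y' \to Y$ of transitive $G$-sets. Put $\nu(X)=\nu(X\to\mathbf{1})$. It is regular if $\nu(f)$ is a unit for every map $f$ of transitive $G$-sets. Here $\nu$ is the unique regular $\mathbf{Q}$-valued measure for $G$ with $\nu(X(n))=(-1)^{n-1}$ for all $n \ge 1$, viewed as valued in $k$ via $\mathbf{Q} \subset k$. **The category $\underline{\mathrm{Perm}}_k(G;\nu)$.** For a finitary $G$-set $X$, let $\mathcal{F}(X)$ be the $k$-space of $G$-invariant functions $X \to k$; the indicator functions $1_W$ of $G$-orbits $W \subset X$ form a basis. For $f \colon X \to Y$ in $\mathbf{S}(G)$, $f_* \colon \mathcal{F}(X) \to \mathcal{F}(Y)$ is the linear map with $f_*(1_W)=\nu(W \to f(W)) \cdot 1_{f(W)}$ for each orbit $W$. A $(Y \times X)$-matrix is an element of $\mathcal{F}(Y \times X)$. The product of $B \in \mathcal{F}(Z \times Y)$ and $A \in \mathcal{F}(Y \times X)$ is $BA=(p_{13})_*(p_{23}^*(B)\cdot p_{12}^*(A)) \in \mathcal{F}(Z \times X)$, where $p_{ij}$ are the projections from $Z \times Y \times X$. The Kronecker product of $A \in \mathcal{F}(Y \times X)$ and $A' \in \mathcal{F}(Y' \times X')$ is $(y,y',x,x') \mapsto A(y,x)A'(y',x')$. The objects of $\underline{\mathrm{Perm}}_k(G;\nu)$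 are formal symbols $\mathrm{Vec}_X$ for finitary $G$-sets $X$; morphisms $\mathrm{Vec}_X \to \mathrm{Vec}_Y$ are $(Y\times X)$-matrices; composition is matrix multiplication; direct sums are given by disjoint union of $G$-sets; the tensor product is $\mathrm{Vec}_X \otimes \mathrm{Vec}_Y=\mathrm{Vec}_{X \times Y}$ on objects and the Kronecker product on morphisms. It is a $k$-linear symmetric monoidal category in which every object is rigid (and self-dual), with $\mathrm{End}(\mathrm{Vec}_{\mathbf{1}})=k$; the trace of an endomorphism is the usual categorical trace in a rigid symmetric monoidal category, an element of $k$. A tensor category (additive $k$-linear category with a $k$-bilinear symmetric monoidal structure, unit $\mathbb{1}$) is pre-Tannakian if: (a) it is abelian and all objects have finite length; (b) all Hom spaces are finite dimensional over $k$; (c) it is rigid; (d) $\mathrm{End}(\mathbb{1})=k$. *)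

(* Defs.v *)
From HB Require Import structures.
From mathcomp Require Import all_boot all_order all_algebra.
From mathcomp Require Import boolp classical_sets functions cardinality fsbigop filter.
From mathcomp Require Import reals topology cantor.

Set Implicit Arguments.
Unset Strict Implicit.
Unset Printing Implicit Defensive.

Import GRing.Theory.
Local Open Scope classical_set_scope.
Local Open Scope ring_scope.

(** The operations only; the axioms, including additivity, are in
    [tensor_category]. *)
Record tensor_data (k : fieldType) := TensorData {
  obj :> Type;
  mor : obj -> obj -> lmodType k;
  idmor : forall X, mor X X;
  mcomp : forall X Y Z, mor Y Z -> mor X Y -> mor X Z;
  tob : obj -> obj -> obj;
  tmor : forall X X' Y Y', mor X X' -> mor Y Y' -> mor (tob X Y) (tob X' Y');
  tunit : obj;
  assoc : forall X Y Z, mor (tob (tob X Y) Z) (tob X (tob Y Z));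
  assocV : forall X Y Z, mor (tob X (tob Y Z)) (tob (tob X Y) Z);
  lunit : forall X, mor (tob tunit X) X;
  runit : forall X, mor (tob X tunit) X;
  braid : forall X Y, mor (tob X Y) (tob Y X) }.

Arguments idmor {k t} X.
Arguments mcomp {k t X Y Z} g f.
Arguments tmor {k t X X' Y Y'} f f'.
Arguments tunit {k} t.
Arguments assoc {k t} X Y Z.
Arguments assocV {k t} X Y Z.
Arguments lunit {k t} X.
Arguments runit {k t} X.
Arguments braid {k t} X Y.

Declare Scope tensor_scope.
Delimit Scope tensor_scope with T.
Local Open Scope tensor_scope.
Notation "g \oc f" := (mcomp g f) (at level 40, left associativity) : tensor_scope.
Notation "X \ot Y" := (tob X Y) (at level 38, left associativity) : tensor_scope.
Notation "f \ox g" := (tmor f g) (at level 38, left associativity) : tensor_scope.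

Section TensorCategory.
Variables (k : fieldType) (C : tensor_data k).
Implicit Types X Y Z W : C.

Definition inverse_mor X Y (f : mor X Y) (g : mor Y X) :=
  g \oc f = idmor X /\ f \oc g = idmor Y.
Definition iso_mor X Y (f : mor X Y) := exists g, inverse_mor f g.
Definition mono_mor X Y (f : mor X Y) :=
  forall W (g h : mor W X), f \oc g = f \oc h -> g = h.
Definition epi_mor X Y (f : mor X Y) :=
  forall W (g h : mor Y W), g \oc f = h \oc f -> g = h.

Definition zero_obj Z :=
  forall X, (forall f : mor Z X, f = 0) /\ (forall f : mor X Z, f = 0).

Definition biproduct X Y S (i : mor X S) (j : mor Y S) (p : mor S X) (q : mor S Y) :=
  [/\ p \oc i = idmor X, q \oc j = idmor Y, p \oc j = 0, q \oc i = 0 &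
      i \oc p + j \oc q = idmor S].

Definition is_kernel N X Y (i : mor N X) (f : mor X Y) :=
  f \oc i = 0 /\
  forall W (g : mor W X), f \oc g = 0 -> exists! h : mor W N, i \oc h = g.
Definition is_cokernel X Y Q (p : mor Y Q) (f : mor X Y) :=
  p \oc f = 0 /\
  forall W (g : mor Y W), g \oc f = 0 -> exists! h : mor Q W, h \oc p = g.

Record tensor_category : Prop := TensorCategory {
  comp1m : forall X Y (f : mor X Y), idmor Y \oc f = f;
  compm1 : forall X Y (f : mor X Y), f \oc idmor X = f;
  compA : forall X Y Z W (h : mor Z W) (g : mor Y Z) (f : mor X Y),
    h \oc (g \oc f) = h \oc g \oc f;
  comp_linearl : forall X Y Z (f : mor X Y), linear (fun g : mor Y Z => g \oc f);
  comp_linearr : forall X Y Z (g : mor Y Z), linear (fun f : mor X Y => g \oc f);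
  has_zero : exists Z, zero_obj Z;
  has_biproducts : forall X Y, exists S i j p q, @biproduct X Y S i j p q;
  tmor1 : forall X Y, idmor X \ox idmor Y = idmor (X \ot Y);
  tmor_comp : forall X X' X'' Y Y' Y'' (f' : mor X' X'') (f : mor X X')
      (g' : mor Y' Y'') (g : mor Y Y'),
    (f' \oc f) \ox (g' \oc g) = (f' \ox g') \oc (f \ox g);
  tmor_linearl : forall X X' Y Y' (g : mor Y Y'),
    linear (fun f : mor X X' => f \ox g);
  tmor_linearr : forall X X' Y Y' (f : mor X X'),
    linear (fun g : mor Y Y' => f \ox g);
  assocK : forall X Y Z, inverse_mor (assoc X Y Z) (assocV X Y Z);
  lunit_iso : forall X, iso_mor (lunit X);
  runit_iso : forall X, iso_mor (runit X);
  assoc_nat : forall X X' Y Y' Z Z' (f : mor X X') (g : mor Y Y') (h : mor Z Z'),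
    assoc X' Y' Z' \oc ((f \ox g) \ox h) = (f \ox (g \ox h)) \oc assoc X Y Z;
  lunit_nat : forall X Y (f : mor X Y),
    lunit Y \oc (idmor (tunit C) \ox f) = f \oc lunit X;
  runit_nat : forall X Y (f : mor X Y),
    runit Y \oc (f \ox idmor (tunit C)) = f \oc runit X;
  braid_nat : forall X X' Y Y' (f : mor X X') (g : mor Y Y'),
    braid X' Y' \oc (f \ox g) = (g \ox f) \oc braid X Y;
  pentagon : forall W X Y Z,
    assoc W X (Y \ot Z) \oc assoc (W \ot X) Y Z =
    (idmor W \ox assoc X Y Z) \oc assoc W (X \ot Y) Z \oc (assoc W X Y \ox idmor Z);
  triangle : forall X Y,
    (idmor X \ox lunit Y) \oc assoc X (tunit C) Y = runit X \ox idmor Y;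
  hexagon : forall X Y Z,
    assoc Y Z X \oc braid X (Y \ot Z) \oc assoc X Y Z =
    (idmor Y \ox braid X Z) \oc assoc Y X Z \oc (braid X Y \ox idmor Z);
  braidK : forall X Y, braid Y X \oc braid X Y = idmor (X \ot Y) }.

Record abelian_category : Prop := AbelianCategory {
  has_kernels : forall X Y (f : mor X Y), exists N (i : mor N X), is_kernel i f;
  has_cokernels : forall X Y (f : mor X Y), exists Q (p : mor Y Q), is_cokernel p f;
  mono_normal : forall X Y (i : mor X Y),
    mono_mor i -> exists Z (f : mor Y Z), is_kernel i f;
  epi_normal : forall X Y (p : mor X Y),
    epi_mor p -> exists Z (f : mor Z X), is_cokernel p f }.

Definition simple_obj X :=
  ~ zero_obj X /\
  forall Y (i : mor Y X), mono_mor i -> zero_obj Y \/ iso_mor i.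

(** Existence of a composition series. *)
Inductive finite_length : C -> Prop :=
| finite_length0 X : zero_obj X -> finite_length X
| finite_lengthS Y X S (i : mor Y X) (p : mor X S) :
    is_kernel i p -> is_cokernel p i -> finite_length Y -> simple_obj S ->
    finite_length X.

Definition is_dual X X' (ev : mor (X' \ot X) (tunit C))
    (coev : mor (tunit C) (X \ot X')) :=
  runit X \oc (idmor X \ox ev) \oc assoc X X' X \oc (coev \ox idmor X) = lunit X /\
  lunit X' \oc (ev \ox idmor X') \oc assocV X' X X' \oc (idmor X' \ox coev) = runit X'.

Definition rigid_obj X := exists X' ev coev, @is_dual X X' ev coev.

(** [t] is the categorical trace of [f], under k -> End(1), [t |-> t *: idm]. *)
Definition is_trace X (f : mor X X) (t : k) :=
  exists X' ev coev, @is_dual X X' ev coev /\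
    ev \oc braid X X' \oc (f \ox idmor X') \oc coev = t *: idmor (tunit C).

Definition nilpotent_mor X (f : mor X X) := exists n, iter n (mcomp f) (idmor X) = 0.

Definition finite_dim (V : lmodType k) :=
  exists n (e : 'I_n -> V), forall v, exists c : 'I_n -> k, v = \sum_i c i *: e i.

Record pre_tannakian : Prop := PreTannakian {
  pt_tensor : tensor_category;
  pt_abelian : abelian_category;
  pt_finite_length : forall X, finite_length X;
  pt_finite_dim : forall X Y, finite_dim (mor X Y);
  pt_rigid : forall X, rigid_obj X;
  pt_unit : bijective (fun t : k => t *: idmor (tunit C)) }.

End TensorCategory.

(** Direct sums are preserved automatically, by linearity. *)
Record tensor_functor (k : fieldType) (C D : tensor_data k) := TensorFunctor {
  fob :> C -> D;
  fmor : forall X Y, {linear mor X Y -> mor (fob X) (fob Y)};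
  fmor1 : forall X, fmor X X (idmor X) = idmor (fob X);
  fmor_comp : forall X Y Z (g : mor Y Z) (f : mor X Y),
    fmor X Z (g \oc f) = fmor Y Z g \oc fmor X Y f;
  ften : forall X Y, mor (fob X \ot fob Y) (fob (X \ot Y));
  fun1 : mor (tunit D) (fob (tunit C));
  ften_iso : forall X Y, iso_mor (ften X Y);
  fun1_iso : iso_mor fun1;
  ften_nat : forall X X' Y Y' (f : mor X X') (g : mor Y Y'),
    ften X' Y' \oc (fmor X X' f \ox fmor Y Y' g) = fmor _ _ (f \ox g) \oc ften X Y;
  ften_assoc : forall X Y Z,
    fmor _ _ (assoc X Y Z) \oc ften (X \ot Y) Z \oc (ften X Y \ox idmor (fob Z)) =
    ften X (Y \ot Z) \oc (idmor (fob X) \ox ften Y Z) \oc assoc (fob X) (fob Y) (fob Z);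
  ften_lunit : forall X,
    fmor _ _ (lunit X) \oc ften (tunit C) X \oc (fun1 \ox idmor (fob X)) = lunit (fob X);
  ften_runit : forall X,
    fmor _ _ (runit X) \oc ften X (tunit C) \oc (idmor (fob X) \ox fun1) = runit (fob X);
  ften_braid : forall X Y,
    fmor _ _ (braid X Y) \oc ften X Y = ften Y X \oc braid (fob X) (fob Y) }.

Definition faithful_functor (k : fieldType) (C D : tensor_data k)
    (F : tensor_functor C D) :=
  forall X Y, injective (fmor F X Y).

Lemma glue_continuous (S T : topologicalType) (D : Type) (p : S -> D)
    (F : D -> S -> T) :
  (forall x, \forall y \near x, p y = p x) -> (forall d, continuous (F d)) ->
  continuous (fun x => F (p x) x).
Proof.
move=> pc Fc x U /= nU; have := Fc (p x) x _ nU.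
rewrite !nbhs_simpl/= => nFU.
by near=> y; rewrite /= (near (pc x) y)//; near: y; exact: nFU.
Unshelve. all: by end_near. Qed.

Lemma clopen_near (S : topologicalType) (A : set S) : clopen A ->
  forall x, \forall y \near x, `[< A y >] = `[< A x >].
Proof.
move=> [oA cA] x; have [Ax|nAx] := pselect (A x).
  have : nbhs x A by exact: open_nbhs_nbhs.
  by apply: filterS => y Ay; rewrite !asboolT.
have : nbhs x (~` A) by apply: open_nbhs_nbhs; split => //; exact: closed_openC.
by apply: filterS => y Ay; rewrite !asboolF.
Qed.

Section Cantor.
Local Notation K := cantor_space.

Lemma cantor_cvgP (F : set_system K) (t : K) : Filter F ->
  (forall i, F [set y | y i = t i]) -> F --> t.
Proof.
move=> FF H; apply/cvg_sup => i; apply/cvg_image.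
  by rewrite eqEsubset; split => // y _; exists (fun=> y).
move=> A /= /nbhs_singleton At.
exists ([set y | y i = t i] `|` [set y | A (y i)]); first by apply: filterS (H i) => y; left.
rewrite eqEsubset; split => [_ [y C <-]|b Ab].
  by case: C => [/= ->|].
by exists (fun=> b) => //; right.
Qed.

Lemma cantor_near n (x : K) :
  nbhs x [set y : K | forall i, (i < n)%N -> y i = x i].
Proof.
elim: n => [|n IH]; first by apply: (@filterE _ (nbhs x)) => y i; rewrite ltn0.
have : nbhs x [set y : K | y n = x n].
  have := @proj_continuous _ (fun=> bool) n x; move=> /(_ [set x n]); apply.
  exact: discrete_set1.
move: IH; apply: filterS2 => y IH e i; rewrite ltnS leq_eqVlt => /orP[/eqP->//|]; exact: IH.
Qed.

Lemma cantor_nbhs (x : K) (A : set K) : nbhs x A ->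
  exists n, forall y, (forall i, (i < n)%N -> y i = x i) -> A y.
Proof.
pose F : set_system K := filter_from [set: nat]
  (fun n => [set y : K | forall i, (i < n)%N -> y i = x i]).
have FF : Filter F.
  apply: filter_from_filter; first by exists 0.
  move=> i j _ _; exists (maxn i j) => // y /= H.
  by split=> l li; apply: H; rewrite leq_max li ?orbT.
have : F --> x.
  by apply: cantor_cvgP => i; exists i.+1 => // y; apply.
by move=> /[apply] -[n _ H]; exists n => y /H.
Qed.

Lemma cantor_continuous (S : topologicalType) (f : S -> K) :
  (forall i x, \forall y \near x, f y i = f x i) -> continuous f.
Proof. by move=> H x; apply: cantor_cvgP => i; exact: H. Qed.

Definition ccons (b : bool) (x : K) : K := fun n => if n is m.+1 then x m else b.
Definition ctail (x : K) : K := fun n => x n.+1.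

Lemma cconsE x : ccons (x 0) (ctail x) = x.
Proof. by apply/funext => -[]. Qed.

Lemma ccons_continuous b : continuous (ccons b).
Proof.
apply: cantor_continuous => -[|i] x; first by apply: (@filterE _ (nbhs x)).
by have := cantor_near i.+1 x; apply: filterS => y; apply.
Qed.

Lemma ctail_continuous : continuous ctail.
Proof.
apply: cantor_continuous => i x.
by have := cantor_near i.+2 x; apply: filterS => y; apply.
Qed.

Definition ceqv (A B : set K) := exists f g : K -> K,
  [/\ continuous f, continuous g,
    forall x, A x -> B (f x) /\ g (f x) = x &
    forall y, B y -> A (g y) /\ f (g y) = y].

Lemma ceqv_refl A : ceqv A A.
Proof. by exists id, id; split => // x. Qed.

Lemma ceqv_sym A B : ceqv A B -> ceqv B A.
Proof. by move=> [f [g [? ? ? ?]]]; exists g, f. Qed.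

Lemma ceqv_trans A B C : ceqv A B -> ceqv B C -> ceqv A C.
Proof.
move=> [f [g [cf cg fP gP]]] [f' [g' [cf' cg' fP' gP']]].
exists (f' \o f), (g \o g'); split.
- by move=> x; apply: continuous_comp; [exact: cf|exact: cf'].
- by move=> x; apply: continuous_comp; [exact: cg'|exact: cg].
- by move=> x /fP[/fP'[? e] ?]; split => //=; rewrite e.
- by move=> x /gP'[/gP[? e] ?]; split => //=; rewrite e.
Qed.

Lemma ceqvU A B A' B' : clopen A -> clopen A' ->
  A `&` B = set0 -> A' `&` B' = set0 ->
  ceqv A A' -> ceqv B B' -> ceqv (A `|` B) (A' `|` B').
Proof.
move=> cA cA' AB AB' [f [g [cf cg fP gP]]] [f' [g' [cf' cg' fP' gP']]].
have nA x : B x -> ~ A x by move=> Bx Ax; rewrite -[False]/(set0 x) -AB.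
have nA' x : B' x -> ~ A' x by move=> Bx Ax; rewrite -[False]/(set0 x) -AB'.
exists (fun x => (if `[<A x>] then f else f') x), (fun x => (if `[<A' x>] then g else g') x).
split.
- by apply: (glue_continuous (F := fun b => if b then f else f') (clopen_near cA)) => -[].
- by apply: (glue_continuous (F := fun b => if b then g else g') (clopen_near cA')) => -[].
- move=> x [Ax|Bx].
    by rewrite (asboolT Ax); have [h1 h2] := fP _ Ax; rewrite (asboolT h1); split => //; left.
  rewrite (asboolF (nA _ Bx)); have [h1 h2] := fP' _ Bx.
  by rewrite (asboolF (nA' _ h1)); split => //; right.
- move=> x [Ax|Bx].
    by rewrite (asboolT Ax); have [h1 h2] := gP _ Ax; rewrite (asboolT h1); split => //; left.
  rewrite (asboolF (nA' _ Bx)); have [h1 h2] := gP' _ Bx.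
  by rewrite (asboolF (nA _ h1)); split => //; right.
Qed.

Let dep n (A : set K) := forall x y : K, (forall i, (i < n)%N -> x i = y i) -> A x -> A y.

Lemma dep_clopen n A : dep n A -> clopen A.
Proof.
move=> dA.
have H B : dep n B -> open B.
  move=> dB; rewrite openE => x Bx; rewrite /interior.
  by have := cantor_near n x; apply: filterS => y e; apply: dB Bx => i /e.
split; first exact: H.
rewrite -[A]setCK; apply: open_closedC; apply: H => x y e nAx Ay.
by apply: nAx; apply: dA Ay => i /e.
Qed.

Lemma clopen_dep A : clopen A -> exists n, dep n A.
Proof.
move=> cA.
have := cantor_space_compact => /compact_near_coveringP.
move=> /(_ nat \oo%classic (fun n x =>
  forall y : K, (forall i, (i < n)%N -> x i = y i) -> A x -> A y)).
case.
- move=> x _; have [n nP] := cantor_nbhs (clopen_near cA x).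
  exists ([set y : K | forall i, (i < n)%N -> y i = x i], [set m | (n <= m)%N]).
    by split; [exact: cantor_near|exact: nbhs_infty_ge].
  move=> [x' m] /= [x'P nm] y yP.
  rewrite -[A x']asboolE -[A y]asboolE nP// -{1}(nP y)//.
  by move=> i ilt; rewrite -yP ?x'P//; exact: leq_trans nm.
- move=> n _ H; exists n => x y e; exact: (H n (leqnn n)).
Qed.

Lemma ceqv_ccons b A : ceqv A [set x | x 0 = b /\ A (ctail x)].
Proof.
exists (ccons b), ctail; split.
- exact: ccons_continuous.
- exact: ctail_continuous.
- by move=> x Ax.
- by move=> x /= [<-] ?; rewrite cconsE.
Qed.

Lemma ceqv_clopen A : clopen A -> A !=set0 -> ceqv [set: K] A.
Proof.
move=> /clopen_dep[n]; elim: n A => [|n IH] A dA [x0 Ax0].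
  suff -> : A = setT by exact: ceqv_refl.
  by rewrite eqEsubset; split => // x _; apply: dA Ax0.
pose h b : set K := [set x | x 0 = b].
pose A' b := [set x | A (ccons b x)].
pose A'' b := [set x | x 0 = b /\ A' b (ctail x)].
have dA' b : dep n (A' b).
  by move=> x y e; apply: dA => -[|i]//; rewrite ltnS => /e.
have dA'' b : dep n.+1 (A'' b).
  move=> x y e /= [<- AA]; split; first by rewrite e.
  by move: AA; apply: dA' => i ilt; rewrite /ctail e.
have hE b : A' b !=set0 -> ceqv (h b) (A'' b).
  move=> ne; apply: (ceqv_trans _ (ceqv_ccons b (A' b))).
  apply: (ceqv_trans _ (IH _ (dA' b) ne)); apply: ceqv_sym.
  have -> : h b = [set x | x 0 = b /\ setT (ctail x)].
    by rewrite eqEsubset; split => x //= [].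
  exact: ceqv_ccons.
have AE : A = A'' true `|` A'' false.
  rewrite eqEsubset; split => x.
    by move=> Ax; case E : (x 0); [left|right]; split => //; rewrite /A' /= -E cconsE.
  by move=> [] [e]; rewrite /A' /= -e cconsE.
have hT : [set: K] = h true `|` h false.
  by rewrite eqEsubset; split => x //= _; rewrite /h /=; case: (x 0); [left|right].
have hC b : clopen (h b).
  by apply: (@dep_clopen 1) => x y e /= <-; rewrite e.
have T2 b : ceqv [set: K] (h b).
  have -> : h b = [set x | x 0 = b /\ setT (ctail x)].
    by rewrite eqEsubset; split => x //= [].
  exact: ceqv_ccons.
have [ne1|e1] := pselect (A' true !=set0); have [ne2|e2] := pselect (A' false !=set0).
- rewrite AE hT; apply: ceqvU => //; try exact: hE; first exact: dep_clopen (dA'' _).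
    by rewrite -subset0 => x [e e']; have := etrans (esym e) e'.
  by rewrite -subset0 => x [[e _] [e' _]]; have := etrans (esym e) e'.
- have -> : A = A'' true.
    rewrite AE eqEsubset; split => x; last by left.
    by case=> // -[_ H]; case: e2; exists (ctail x).
  exact: ceqv_trans (T2 true) (hE _ ne1).
- have -> : A = A'' false.
    rewrite AE eqEsubset; split => x; last by right.
    by case=> // -[_ H]; case: e1; exists (ctail x).
  exact: ceqv_trans (T2 false) (hE _ ne2).
- exfalso; rewrite AE in Ax0; case: Ax0 => -[_ H].
    by apply: e1; exists (ctail x0).
  by apply: e2; exists (ctail x0).
Qed.
End Cantor.
Record cantorSpace := CantorSpace {
  cantor_sort :> topologicalType;
  cantor_sortP : exists (f : continuousType cantor_sort cantor_space)
    (g : continuousType cantor_space cantor_sort), cancel f g /\ cancel g f }.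

Record homeo (T : topologicalType) := Homeo {
  hfun :> continuousType T T;
  hinv : continuousType T T;
  hfunK : cancel hfun hinv;
  hinvK : cancel hinv hfun }.

Section HomeoGroup.
Variable T : topologicalType.

Lemma homeo_eq (g h : homeo T) : g =1 h -> g = h.
Proof.
case: g h => [g g' gK gK'] [h h' hK hK'] /= /continuousEP e.
rewrite -{h}e in hK hK' *.
have e' : g' = h' by apply/continuousEP => x; rewrite -{1}(hK' x) gK.
rewrite -{h'}e' in hK hK' *; congr Homeo; exact: Prop_irrelevance.
Qed.

HB.instance Definition _ := gen_eqMixin (homeo T).
HB.instance Definition _ := gen_choiceMixin (homeo T).

Definition homeo1 : homeo T :=
  @Homeo T (@idfun T) (@idfun T) (fun=> erefl) (fun=> erefl).
Definition homeoV (g : homeo T) : homeo T :=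
  Homeo (@hinvK T g) (@hfunK T g).
Definition homeoM (g h : homeo T) : homeo T :=
  @Homeo T (g \o h) (hinv h \o hinv g)
    (can_comp (@hfunK T g) (@hfunK T h)) (can_comp (@hinvK T h) (@hinvK T g)).

Fact homeoA : associative homeoM. Proof. by move=> *; exact: homeo_eq. Qed.
Fact homeo1g : left_id homeo1 homeoM. Proof. by move=> *; exact: homeo_eq. Qed.
Fact homeog1 : right_id homeo1 homeoM. Proof. by move=> *; exact: homeo_eq. Qed.
Fact homeoVg : left_inverse homeo1 homeoV homeoM.
Proof. by move=> g; apply: homeo_eq => x /=; rewrite hfunK. Qed.
Fact homeogV : right_inverse homeo1 homeoV homeoM.
Proof. by move=> g; apply: homeo_eq => x /=; rewrite hinvK. Qed.

HB.instance Definition _ :=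
  isGroup.Build (homeo T) homeoA homeo1g homeog1 homeoVg homeogV.

(** The group topology for which the setwise stabilizers of finite families
    of clopen sets form a neighborhood basis of 1. *)
Definition homeo_open (U : set (homeo T)) :=
  forall g, U g -> exists2 As : seq (set T), (forall A, A \in As -> clopen A) &
    forall h : homeo T, (forall A, A \in As -> h @` A = A) -> U (g * h)%g.

End HomeoGroup.

Record gset (T : topologicalType) := GSet {
  gcar :> Type;
  gact : homeo T -> gcar -> gcar;
  act1 : forall x, gact 1%g x = x;
  actM : forall g h x, gact (g * h)%g x = gact g (gact h x);
  stab_open : forall x, homeo_open [set g | gact g x = x] }.

Arguments gact {T g} _ _ : rename.

Definition finitary T (X : gset T) :=
  exists n (s : 'I_n -> X), forall x, exists i g, x = gact g (s i).

Record fgset (T : topologicalType) := FGSet {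
  fg_gset :> gset T;
  fgP : finitary fg_gset }.

Definition transitive_gset T (X : gset T) :=
  exists x : X, forall y, exists g, y = gact g x.

Record gmap T (X Y : gset T) := GMap {
  gfun :> X -> Y;
  gmapP : forall g x, gfun (gact g x) = gact g (gfun x) }.

Section GSets.
Variable T : topologicalType.
Implicit Types X Y Z : gset T.

Lemma actK X g : cancel (@gact T X g) (gact g^-1%g).
Proof. by move=> x; rewrite -actM mulVg act1. Qed.
Lemma actKV X g : cancel (@gact T X g^-1%g) (gact g).
Proof. by move=> x; rewrite -actM mulgV act1. Qed.

Definition gmap_id X : gmap X X := @GMap T X X id (fun _ _ => erefl).

Program Definition gmap_comp X Y Z (g : gmap Y Z) (f : gmap X Y) : gmap X Z :=
  @GMap T X Z (g \o f) _.
Next Obligation. by move=> X Y Z g f h x /=; rewrite !gmapP. Qed.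

(** [X] is the coproduct of [X1] and [X2], along [i1] and [i2]. *)
Definition gcoprod X1 X2 X (i1 : gmap X1 X) (i2 : gmap X2 X) :=
  [/\ injective i1, injective i2, forall x1 x2, i1 x1 <> i2 x2 &
      forall x, (exists x1, i1 x1 = x) \/ (exists x2, i2 x2 = x)].

(** [f'] is the base change of [f] along [h]. *)
Definition gcartesian X Y X' Y' (f : gmap X Y) (h : gmap Y' Y)
    (f' : gmap X' Y') (h' : gmap X' X) :=
  (forall x', f (h' x') = h (f' x')) /\
  forall x y', f x = h y' -> exists! x', h' x' = x /\ f' x' = y'.

Program Definition gset1 : gset T :=
  @GSet T unit (fun _ x => x) _ _ _.
Next Obligation. by []. Qed.
Next Obligation. by []. Qed.
Next Obligation. by move=> x g _; exists [::]. Qed.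

Lemma gset1_finitary : finitary gset1.
Proof. by exists 1%N, (fun=> tt) => -[]; exists ord0, 1%g. Qed.

Definition fgset1 : fgset T := FGSet gset1_finitary.

Definition to1 X : gmap X gset1 := @GMap T X gset1 (fun=> tt) (fun _ _ => erefl).

Program Definition gprod X Y : gset T :=
  @GSet T (X * Y)%type (fun g p => (gact g p.1, gact g p.2)) _ _ _.
Next Obligation. by move=> X Y [x y] /=; rewrite !act1. Qed.
Next Obligation. by move=> X Y g h [x y] /=; rewrite !actM. Qed.
Next Obligation.
move=> X Y [x y] g /= [gx gy].
have [A Ac AP] := @stab_open T X x g gx; have [B Bc BP] := @stab_open T Y y g gy.
exists (A ++ B) => [C|h hP]; first by rewrite mem_cat => /orP[/Ac|/Bc].
rewrite /=; congr pair.
  by apply: AP => C CA; apply: hP; rewrite mem_cat CA.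
by apply: BP => C CA; apply: hP; rewrite mem_cat CA orbT.
Qed.

Definition gstable X (A : set X) := forall g x, A x -> A (gact g x).

Section SubGSet.
Variables (X : gset T) (A : set X) (stA : gstable A).

Definition sub_act (g : homeo T) (x : set_type A) : set_type A :=
  SigSub (mem_set (stA g (set_mem (valP x)))).

Program Definition sub_gset : gset T := @GSet T (set_type A) sub_act _ _ _.
Next Obligation. by move=> x; apply: val_inj; rewrite /= act1. Qed.
Next Obligation. by move=> g h x; apply: val_inj; rewrite /= actM. Qed.
Next Obligation.
move=> x g gx.
have [|As Ac AP] := @stab_open T X (val x) g; first by rewrite /= -[in RHS]gx.
by exists As => // h /AP gh; apply: val_inj.
Qed.
End SubGSet.

Lemma sub_finitary (X : fgset T) (A : set X) (stA : gstable A) :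
  finitary (sub_gset stA).
Proof.
have [n [s sP]] := fgP X.
have [[x0]|ne] := pselect (inhabited (set_type A)); last first.
  exists 0%N, (fun i : 'I_0 => False_rect _ (notF (ltn_ord i))) => x.
  by case: ne.
pose s' i : set_type A :=
  match pselect (A (s i)) with left h => SigSub (mem_set h) | right _ => x0 end.
exists n, s' => x; have [i [g xE]] := sP (val x); exists i, g; apply: val_inj => /=.
rewrite /s'; case: pselect => [h|nA] //=.
case: nA; rewrite -(actK g (s i)) -xE; exact: (stA _ _ (set_mem (valP x))).
Qed.

Definition sub_fgset (X : fgset T) (A : set X) (stA : gstable A) : fgset T :=
  FGSet (sub_finitary stA).

Definition orbit_set X (x : X) : set X := [set y | exists g, y = gact g x].

Lemma orbit_stable X (W : set X) : range (@orbit_set X) W -> gstable W.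
Proof. by move=> [x _ <-] g _ [h ->]; exists (g * h)%g; rewrite actM. Qed.

Lemma orbit_image X Y (f : gmap X Y) (W : set X) :
  range (@orbit_set X) W -> range (@orbit_set Y) (f @` W).
Proof.
move=> [x _ <-]; exists (f x) => //; rewrite eqEsubset; split => y.
  by move=> [g ->]; exists (gact g x); [exists g|rewrite gmapP].
by move=> [_ [g ->] <-]; exists g; rewrite gmapP.
Qed.

Definition gorbit X := set_type (range (@orbit_set X)).

Definition orbit_fgset (X : fgset T) (W : gorbit X) : fgset T :=
  sub_fgset (orbit_stable (set_mem (valP W))).

Definition image_orbit X Y (f : gmap X Y) (W : gorbit X) : gorbit Y :=
  SigSub (mem_set (orbit_image f (set_mem (valP W)))).

(** The restriction W -> f(W) of [f]. *)
Program Definition orbit_gmap (X Y : fgset T) (f : gmap X Y) (W : gorbit X) :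
    gmap (orbit_fgset W) (orbit_fgset (image_orbit f W)) :=
  @GMap T (orbit_fgset W) (orbit_fgset (image_orbit f W))
    (fun x => SigSub (mem_set (imageP f (set_mem (valP x))))) _.
Next Obligation. by move=> X Y f W g x; apply: val_inj; rewrite /= gmapP. Qed.

Lemma orbit_inhabited X (W : gorbit X) : exists x, val W x.
Proof.
by have [x _ <-] := set_mem (valP W); exists x, 1%g; rewrite act1.
Qed.

Definition orbit_repr X (W : gorbit X) : X := projT1 (cid (orbit_inhabited W)).

End GSets.

Section MapSpace.
Variables (T : topologicalType) (n : nat).

Local Notation Ymap := (continuousType T (discrete_topology 'I_n)).

Lemma map_near (p : Ymap) x : \forall y \near x, p y = p x.
Proof.
have := @cts_fun _ _ p x [set p x]; apply; exact: discrete_set1.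
Qed.

Lemma map_stab (p : Ymap) : exists2 As : seq (set T),
  (forall A, A \in As -> clopen A) &
  forall h : homeo T, (forall A, A \in As -> h @` A = A) -> p \o hinv h = p.
Proof.
exists [seq p @^-1` [set i] | i : 'I_n] => [A /mapP[i _ ->]|h hP].
  apply: preimage_clopen; last exact: cts_fun.
  by split; [exact: discrete_open|exact: discrete_closed].
apply/funext => x /=.
have : (p @^-1` [set p x]) x by [].
rewrite -[in X in X -> _](hP (p @^-1` [set p x])); last exact: fintype.image_f.
by move=> [y /= e hy]; rewrite -{1}hy hfunK.
Qed.

Program Definition Ygset : gset T :=
  @GSet T Ymap (fun g p => p \o hinv g) _ _ _.
Next Obligation. by move=> p; apply/continuousEP. Qed.
Next Obligation. by move=> g h p; apply/continuousEP. Qed.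
Next Obligation.
move=> p g gp; have [As Ac AP] := map_stab p; exists As => // h /AP hp.
apply/continuousEP => x /=.
have := f_equal (fun q : Ymap => q x) gp => /= <-.
exact: (f_equal (fun q => q (hinv g x)) hp).
Qed.

Lemma surj_stable : @gstable T Ygset [set p : Ymap | forall i, exists x, p x = i].
Proof. by move=> g p pP i; have [x <-] := pP i; exists (g x); rewrite /= hfunK. Qed.

End MapSpace.

Section CantorGSets.
Variable T : cantorSpace.

(** Two locally constant maps with the same image differ by a homeomorphism. *)
Lemma cantor_homogeneous (D : Type) (p q : T -> D) :
  (forall x, \forall y \near x, p y = p x) ->
  (forall x, \forall y \near x, q y = q x) ->
  range p = range q -> exists g : homeo T, forall x, q (g x) = p x.
Proof.
move=> pc qc pq; have [f [f' [fK f'K]]] := cantor_sortP T.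
have lc (r : T -> D) : (forall x, \forall y \near x, r y = r x) ->
    forall x, \forall y \near x, r (f' y) = r (f' x).
  by move=> rc x; have := @cts_fun _ _ f' x _ (rc (f' x)).
have cl (r : T -> D) d : (forall x, \forall y \near x, r y = r x) ->
    clopen [set x | r (f' x) = d].
  move=> rc.
  have H (E : set D) : open [set x | E (r (f' x))].
    rewrite openE => x Ex; rewrite /interior.
    by have := lc r rc x; apply: filterS => y /= ->.
  split; first exact: (H [set d]).
  rewrite -[X in closed X]setCK; apply: open_closedC; exact: (H (~` [set d])).
have ex d : ceqv [set x | p (f' x) = d] [set x | q (f' x) = d].
  have [[y yE]|ne] := pselect (exists y, p y = d); last first.
    suff -> : [set x | q (f' x) = d] = [set x | p (f' x) = d] by exact: ceqv_refl.
    rewrite eqEsubset; split => x /= e; case: ne; last by exists (f' x).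
    have : range q d by exists (f' x).
    by rewrite -pq => -[y _ ?]; exists y.
  have [z _ zE] : range q d by rewrite -pq; exists y.
  apply: (@ceqv_trans _ setT).
    by apply: ceqv_sym; apply: ceqv_clopen; [exact: cl|exists (f y); rewrite /= fK].
  by apply: ceqv_clopen; [exact: cl|exists (f z); rewrite /= fK].
have [u uP] := choice ex; have [v vP] := choice uP.
pose F x := f' (u (p x) (f x)); pose G x := f' (v (q x) (f x)).
have ccF (w : D -> cantor_space -> cantor_space) (r : T -> D) :
    (forall x, \forall y \near x, r y = r x) -> (forall d, continuous (w d)) ->
    continuous (fun x => f' (w (r x) (f x))).
  move=> rc wc.
  apply: (glue_continuous (F := fun d x => f' (w d (f x))) rc) => d x.
  apply: (@continuous_comp _ _ _ (fun x => w d (f x)) f'); last exact: cts_fun.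
  by apply: continuous_comp; [exact: cts_fun|exact: wc].
have cF : continuous F by apply: ccF => // d; case: (vP d).
have cG : continuous G by apply: ccF => // d; case: (vP d).
have qF x : q (F x) = p x by case: (vP (p x)) => _ _ /(_ (f x)); rewrite /= fK => -[].
have pG x : p (G x) = q x by case: (vP (q x)) => _ _ _ /(_ (f x)); rewrite /= fK => -[].
have FK : cancel F G.
  move=> x; rewrite /G qF /F f'K.
  by case: (vP (p x)) => _ _ /(_ (f x)); rewrite /= fK => -[]// _ ->; rewrite fK.
have GK : cancel G F.
  move=> x; rewrite /F pG /G f'K.
  by case: (vP (q x)) => _ _ _ /(_ (f x)); rewrite /= fK => -[]// _ ->; rewrite fK.
by exists (@Homeo T (mkcts cF) (mkcts cG) FK GK).
Qed.

Lemma code_finitary (X : gset T) (D : finType) (c : X -> D) :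
  (forall x y, c x = c y -> exists g, x = gact g y) -> finitary X.
Proof.
move=> cP; have [[x0]|ne] := pselect (inhabited X); last first.
  exists 0%N, (fun i : 'I_0 => False_rect _ (notF (ltn_ord i))) => x.
  by case: ne.
pose s (i : 'I_#|D|) :=
  if pselect (exists x, c x = enum_val i) is left e then projT1 (cid e) else x0.
exists #|D|, s => x; exists (enum_rank (c x)); apply: cP; rewrite /s.
case: pselect => [e|[]]; last by exists x; rewrite enum_rankK.
by case: cid => y /= ->; rewrite enum_rankK.
Qed.

Lemma Y_finitary n : finitary (Ygset T n).
Proof.
apply: (@code_finitary (Ygset T n) _
  (fun p : continuousType T (discrete_topology 'I_n) =>
     [set i : 'I_n | `[< exists x, p x = i >]]%SET)).
move=> p q e.
have [g gP] : exists g : homeo T, forall x, p (g x) = q x.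
  apply: cantor_homogeneous; [exact: map_near|exact: map_near|].
  rewrite eqEsubset; split => i [x _ xi].
    have : i \in [set i | `[< exists x, q x = i >]]%SET.
      by rewrite inE; apply/asboolP; exists x.
    by rewrite -e inE => /asboolP[y]; exists y.
  have : i \in [set i | `[< exists x, p x = i >]]%SET.
    by rewrite inE; apply/asboolP; exists x.
  by rewrite e inE => /asboolP[y]; exists y.
by exists g; apply/continuousEP => x /=; rewrite -gP hinvK.
Qed.

(** [Y_fgset n] and [X_fgset n] are the G-sets of all, resp. all surjective,
    continuous maps to a discrete set with [n] elements. *)
Definition Y_fgset n : fgset T := FGSet (Y_finitary n).
Definition X_fgset n : fgset T := @sub_fgset T (Y_fgset n) _ (@surj_stable T n).

Lemma finitary_stab (X : fgset T) : exists n (s : 'I_n -> X) (As : seq (set T)),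
  [/\ forall x, exists i g, x = gact g (s i),
      forall A, A \in As -> clopen A &
      forall i (h : homeo T), (forall A, A \in As -> h @` A = A) -> gact h (s i) = s i].
Proof.
have [n [s sP]] := fgP X; exists n, s.
have ex i : exists As : seq (set T), (forall A, A \in As -> clopen A) /\
    forall h : homeo T, (forall A, A \in As -> h @` A = A) -> gact h (s i) = s i.
  have [|As Ac AP] := @stab_open T X (s i) 1%g; first exact: act1.
  by exists As; split => // h /AP; rewrite /= mul1g.
have [As AsP] := choice ex; exists (flatten [seq As i | i : 'I_n]); split => //.
  by move=> A /flatten_mapP[i _]; exact: (AsP i).1.
move=> i h hP; apply: (AsP i).2 => A AA; apply: hP.
by apply/flatten_mapP; exists i => //; exact: mem_enum.
Qed.

Lemma prod_finitary (X Y : fgset T) : finitary (gprod X Y).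
Proof.
have [n [s [As [sP Ac AP]]]] := finitary_stab X.
have [m [t [Bs [tP Bc BP]]]] := finitary_stab Y.
have [i iP] := choice sP; have [g gP] := choice iP.
have [j jP] := choice tP; have [h hP] := choice jP.
pose a := size As; pose b := size Bs.
pose D := ({ffun 'I_a -> bool} * {ffun 'I_b -> bool})%type.
pose code (z : gprod X Y) (x : T) : D :=
  ([ffun l : 'I_a => `[< nth set0 As l (hinv (g z.1) x) >]],
   [ffun l : 'I_b => `[< nth set0 Bs l (hinv (h z.2) x) >]]).
have near_code (Cs : seq (set T)) (w : homeo T) :
    (forall A, A \in Cs -> clopen A) -> forall x, \forall y \near x,
    [ffun l : 'I_(size Cs) => `[< nth set0 Cs l (hinv w y) >]] =
    [ffun l : 'I_(size Cs) => `[< nth set0 Cs l (hinv w x) >]].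
  move=> Cc x.
  have : \forall y \near x, forall l : 'I_(size Cs),
      `[< nth set0 Cs l (hinv w y) >] = `[< nth set0 Cs l (hinv w x) >].
    apply: filter_forall => l.
    have := clopen_near (Cc _ (mem_nth set0 (ltn_ord l))) (hinv w x).
    by move=> /(@cts_fun _ _ (hinv w) x).
  by apply: filterS => y e; apply/ffunP => l; rewrite !ffunE.
have lc z x : \forall y \near x, code z y = code z x.
  have := near_code As (g z.1) Ac x; have := near_code Bs (h z.2) Bc x.
  by apply: filterS2 => y e1 e2; rewrite /code e1 e2.
apply: (@code_finitary _ _ (fun z : gprod X Y => (i z.1, j z.2,
  [set d | `[< exists x, code z x = d >]]%SET))) => z z' [ei ej ec].
have [w wP] : exists w : homeo T, forall x, code z (w x) = code z' x.
  apply: cantor_homogeneous => //; rewrite eqEsubset; split => d [x _ xd].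
    have : d \in [set d | `[< exists x, code z' x = d >]]%SET.
      by rewrite inE; apply/asboolP; exists x.
    by rewrite -ec inE => /asboolP[y]; exists y.
  have : d \in [set d | `[< exists x, code z x = d >]]%SET.
    by rewrite inE; apply/asboolP; exists x.
  by rewrite ec inE => /asboolP[y]; exists y.
have fixes (Cs : seq (set T)) (u v : homeo T) :
    (forall x (l : 'I_(size Cs)),
      `[< nth set0 Cs l (hinv u (w x)) >] = `[< nth set0 Cs l (hinv v x) >]) ->
    forall A, A \in Cs -> (u^-1 * w * v)%g @` A = A.
  move=> H A ACs.
  have {}H x : A (hinv u (w x)) = A (hinv v x).
    have lt : (index A Cs < size Cs)%N by rewrite index_mem.
    have := H x (Ordinal lt); rewrite /= nth_index// => e.
    by apply/propext; split => /asboolP; [rewrite e|rewrite -e] => /asboolP.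
  rewrite eqEsubset; split => x.
    by move=> [y Ay <-]; rewrite /= H hfunK.
  move=> Ax; exists (hinv v (hinv w (u x))); last by rewrite /= !hinvK hfunK.
  by rewrite -H hinvK hfunK.
have e1 : z.1 = gact w z'.1.
  have E : gact ((g z.1)^-1 * w * g z'.1)%g (s (i z.1)) = s (i z.1).
    apply: AP; apply: fixes => x l.
    by have := congr1 (fun d : D => d.1 l) (wP x); rewrite /code /= !ffunE.
  by rewrite [in LHS](gP z.1) [in RHS](gP z'.1) -ei -[in LHS]E !actM actKV.
have e2 : z.2 = gact w z'.2.
  have E : gact ((h z.2)^-1 * w * h z'.2)%g (t (j z.2)) = t (j z.2).
    apply: BP; apply: fixes => x l.
    by have := congr1 (fun d : D => d.2 l) (wP x); rewrite /code /= !ffunE.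
  by rewrite [in LHS](hP z.2) [in RHS](hP z'.2) -ej -[in LHS]E !actM actKV.
by exists w; case: z z' e1 e2 {ei ej ec wP fixes} => [? ?] [? ?] /= -> ->.
Qed.

Definition prod_fgset (X Y : fgset T) : fgset T := FGSet (prod_finitary X Y).

End CantorGSets.

(** Values on maps with a non-transitive target are irrelevant. *)
Record gmeasure (T : topologicalType) (R : comPzRingType) := GMeasure {
  gmu :> forall X Y : fgset T, gmap X Y -> R;
  gmu_iso : forall (X Y : fgset T) (f : gmap X Y), transitive_gset Y ->
    bijective f -> gmu f = 1;
  gmu_add : forall (X1 X2 X Y : fgset T) (i1 : gmap X1 X) (i2 : gmap X2 X)
      (f : gmap X Y), transitive_gset Y -> gcoprod i1 i2 ->
    gmu f = gmu (gmap_comp f i1) + gmu (gmap_comp f i2);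
  gmu_comp : forall (X Y Z : fgset T) (g : gmap Y Z) (f : gmap X Y),
    transitive_gset Y -> transitive_gset Z ->
    gmu (gmap_comp g f) = gmu g * gmu f;
  gmu_base_change : forall (X Y X' Y' : fgset T) (f : gmap X Y) (h : gmap Y' Y)
      (f' : gmap X' Y') (h' : gmap X' X),
    transitive_gset Y -> transitive_gset Y' -> gcartesian f h f' h' ->
    gmu f' = gmu f }.

Arguments gmu {T R} _ {X Y} f.

Definition gmu_obj T R (mu : gmeasure T R) (X : fgset T) : R :=
  @gmu T R mu X (fgset1 T) (to1 X).

Definition regular_measure T (R : comUnitRingType) (mu : gmeasure T R) :=
  forall (X Y : fgset T) (f : gmap X Y), transitive_gset X -> transitive_gset Y ->
    gmu mu f \is a GRing.unit.

Section InvariantFunctions.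
Variables (k : fieldType) (T : topologicalType).
Implicit Types X Y Z : gset T.

Definition ginvariant X : {pred X -> k^o} :=
  [pred f : X -> k^o | `[< forall g x, f (gact g x) = f x >]].
Arguments ginvariant X : clear implicits.

Record inv_fun X := InvFun { ifun :> X -> k^o; ifunP : ifun \in ginvariant X }.

HB.instance Definition _ X := [isSub for @ifun X].
HB.instance Definition _ X := [Choice of inv_fun X by <:].

Lemma invariantP X (f : X -> k^o) :
  reflect (forall g x, f (gact g x) = f x) (f \in ginvariant X).
Proof. exact: asboolP. Qed.

Fact invariant_submod X : submod_closed (ginvariant X).
Proof.
split=> [|a f h /invariantP fP /invariantP hP]; first exact/invariantP.
by apply/invariantP => g x; rewrite !fctE fP hP.
Qed.
HB.instance Definition _ X :=
  GRing.isSubmodClosed.Build k (X -> k^o) (ginvariant X) (invariant_submod X).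
HB.instance Definition _ X := [SubChoice_isSubLmodule of inv_fun X by <:].

Definition mk_inv_fun X (f : X -> k) (fP : forall g x, f (gact g x) = f x) :
  inv_fun X := InvFun (introT (invariantP f) fP).

Lemma inv_funE X (f : inv_fun X) g x : f (gact g x) = f x.
Proof. by have /invariantP := ifunP f. Qed.

Program Definition inv_mul X (f h : inv_fun X) : inv_fun X :=
  @mk_inv_fun X (fun x => (f x : k) * h x) _.
Next Obligation. by move=> X f h g x /=; rewrite !inv_funE. Qed.

Program Definition inv_pullback X Y (f : gmap X Y) (h : inv_fun Y) : inv_fun X :=
  @mk_inv_fun X (fun x => h (f x)) _.
Next Obligation. by move=> X Y f h g x /=; rewrite gmapP inv_funE. Qed.

(** f_*(phi)(y) is the sum of phi(W) nu(W -> f(W)) over the orbits W with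
    y in f(W); it is a finite sum. *)
Program Definition inv_pushforward (nu : gmeasure T rat) (X Y : fgset T)
    (f : gmap X Y) (phi : inv_fun X) : inv_fun Y :=
  @mk_inv_fun Y (fun y => \sum_(W \in [set W : gorbit X | (f @` val W) y])
    (phi (orbit_repr W) : k) * ratr (gmu nu (orbit_gmap f W))) _.
Next Obligation.
move=> nu X Y f phi g y /=; apply: eq_fsbigl.
rewrite eqEsubset; split => W /= WP;
  have st := orbit_stable (orbit_image f (set_mem (valP W))).
  by rewrite -(actK g y); exact: st.
exact: st.
Qed.

End InvariantFunctions.

Section Perm.
Variables (k : fieldType) (T : cantorSpace) (nu : gmeasure T rat).
Implicit Types X Y Z : fgset T.
Local Notation "X ** Y" := (prod_fgset X Y) (at level 39, left associativity).

Definition mx X Y := inv_fun k (Y ** X).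

Definition proj12 Z Y X : gmap (Z ** (Y ** X)) (Z ** Y) :=
  @GMap T (Z ** (Y ** X)) (Z ** Y) (fun p => (p.1, p.2.1)) (fun _ _ => erefl).
Definition proj13 Z Y X : gmap (Z ** (Y ** X)) (Z ** X) :=
  @GMap T (Z ** (Y ** X)) (Z ** X) (fun p => (p.1, p.2.2)) (fun _ _ => erefl).
Definition proj23 Z Y X : gmap (Z ** (Y ** X)) (Y ** X) :=
  @GMap T (Z ** (Y ** X)) (Y ** X) (fun p => p.2) (fun _ _ => erefl).

(** The factors of Z x Y x X are numbered from the left. *)
Definition mxmul X Y Z (B : mx Y Z) (A : mx X Y) : mx X Z :=
  inv_pushforward nu (proj13 Z Y X)
    (inv_mul (inv_pullback (proj12 Z Y X) B) (inv_pullback (proj23 Z Y X) A)).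

Program Definition kronecker X X' Y Y' (A : mx X X') (A' : mx Y Y') :
    mx (X ** Y) (X' ** Y') :=
  @mk_inv_fun k T ((X' ** Y') ** (X ** Y))
    (fun p => (A (p.1.1, p.2.1) : k) * A' (p.1.2, p.2.2)) _.
Next Obligation.
move=> X X' Y Y' A A' g [[x' y'] [x y]] /=.
congr (_ * _); [exact: (inv_funE A g (x', x))|exact: (inv_funE A' g (y', y))].
Qed.

(** The matrix of a map f: 1_x is sent to 1_{f(x)}. *)
Program Definition graph_mx X Y (f : gmap X Y) : mx X Y :=
  @mk_inv_fun k T (Y ** X) (fun p => (`[< p.1 = f p.2 >])%:R) _.
Next Obligation.
move=> X Y f g [y x] /=; congr (nat_of_bool _)%:R; apply/asbool_equiv_eq.
by rewrite gmapP; split => [/(can_inj (actK g))|->].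
Qed.

Definition gassoc X Y Z : gmap ((X ** Y) ** Z) (X ** (Y ** Z)) :=
  @GMap T ((X ** Y) ** Z) (X ** (Y ** Z)) (fun p => (p.1.1, (p.1.2, p.2)))
    (fun _ _ => erefl).
Definition gassocV X Y Z : gmap (X ** (Y ** Z)) ((X ** Y) ** Z) :=
  @GMap T (X ** (Y ** Z)) ((X ** Y) ** Z) (fun p => ((p.1, p.2.1), p.2.2))
    (fun _ _ => erefl).
Definition glunit X : gmap (fgset1 T ** X) X :=
  @GMap T (fgset1 T ** X) X (fun p => p.2) (fun _ _ => erefl).
Definition grunit X : gmap (X ** fgset1 T) X :=
  @GMap T (X ** fgset1 T) X (fun p => p.1) (fun _ _ => erefl).
Definition gswap X Y : gmap (X ** Y) (Y ** X) :=
  @GMap T (X ** Y) (Y ** X) (fun p => (p.2, p.1)) (fun _ _ => erefl).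

(** Direct sums are not part of the data: that they are given by disjoint
    unions is a property of this category. *)
Definition Perm : tensor_data k := {|
  obj := fgset T;
  mor := fun X Y => mx X Y : lmodType k;
  idmor := fun X => graph_mx (gmap_id X);
  mcomp := mxmul;
  tob := @prod_fgset T;
  tmor := kronecker;
  tunit := fgset1 T;
  assoc := fun X Y Z => graph_mx (gassoc X Y Z);
  assocV := fun X Y Z => graph_mx (gassocV X Y Z);
  lunit := fun X => graph_mx (glunit X);
  runit := fun X => graph_mx (grunit X);
  braid := fun X Y => graph_mx (gswap X Y) |}.

Definition Vec X : Perm := X.

End Perm.

(* Main.v *)
From HB Require Import structures.
From mathcomp Require Import all_boot all_order all_algebra.
From mathcomp Require Import boolp classical_sets functions cardinality fsbigop filter.
From mathcomp Require Import reals topology cantor.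
Require Import Defs.

Set Implicit Arguments.
Unset Strict Implicit.
Unset Printing Implicit Defensive.

Import GRing.Theory.
Local Open Scope ring_scope.

(** A locally constant map from the Cantor space to a finite set D is
    determined, up to homeomorphisms, by its image. The orbits on Y(D), the
    G-set of all such maps, are therefore the X(S) for S a non-empty subset of
    D, and a map of G-sets X(S) -> X(Q) induced by a surjection S -> Q has
    measure (-1)^(|S| - |Q|). For a subset U of D let e_U be the indicator of
    the maps with values in U. An inclusion-exclusion argument shows that the
    push-forward along a map induced by h : D -> E sends e_U to e_(h(U))
    ([pushforward_range_within]).

    Applied to E x E, this says that the matrices e_R on Y(E), for R a binary
    relation on E, multiply by composition of relations:
    e_S e_R = e_(S o R) ([mxmul_range_within]). The trace of e_R is the
    measure of Y(D) for D the set of fixed points of R, hence 1 if R has a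
    fixed point and 0 otherwise. A linear function that kills nilpotents cannot
    distinguish a relation R all of whose long powers are full from the full
    relation F, but the trace can if R has no fixed points. On three points
    the relation R of being different has this property: R R, R F, F R and
    F F are all equal to F, so e_R - e_F has square zero ([nilp_square]) and
    trace 0 - 1 = -1 ([nilp_trace]).

    On the other hand, in an abelian rigid category nilpotent endomorphisms
    have trace zero ([nilpotent_dtrace0]): f = i p with i the inclusion of the
    image, and by cyclicity of the trace ([dtraceC]) f has the trace of p i,
    which is nilpotent of lower order. As symmetric monoidal functors preserve
    traces ([functor_dtrace]), the category of permutation modules has no such
    functor to a pre-Tannakian category. *)

(** * Traces in rigid symmetric monoidal categories *)

Section Traces.
Local Open Scope tensor_scope.
Variables (k : fieldType) (C : tensor_data k) (tC : tensor_category C).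
Implicit Types X Y Z W : C.
Local Notation "1" := (tunit C) : tensor_scope.
Local Notation "'id_ X" := (idmor X) (at level 8, X at level 2, format "''id_' X").

Lemma comp0m X Y Z (f : mor X Y) : (0 : mor Y Z) \oc f = 0.
Proof. by have := comp_linearl tC (Z := Z) f (-1) 0 0; rewrite scaler0 addr0 scaleN1r addNr. Qed.

Lemma compm0 X Y Z (g : mor Y Z) : g \oc (0 : mor X Y) = 0.
Proof. by have := comp_linearr tC (X := X) g (-1) 0 0; rewrite scaler0 addr0 scaleN1r addNr. Qed.

Lemma compZl X Y Z a (g : mor Y Z) (f : mor X Y) : (a *: g) \oc f = a *: (g \oc f).
Proof. by have := comp_linearl tC f a g 0; rewrite addr0 comp0m addr0. Qed.

Lemma compZr X Y Z a (g : mor Y Z) (f : mor X Y) : g \oc (a *: f) = a *: (g \oc f).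
Proof. by have := comp_linearr tC g a f 0; rewrite addr0 compm0 addr0. Qed.

Lemma tmor0l X X' Y Y' (g : mor Y Y') : (0 : mor X X') \ox g = 0.
Proof. by have := tmor_linearl tC (X := X) (X' := X') g (-1) 0 0; rewrite scaler0 addr0 scaleN1r addNr. Qed.

Lemma tmor_compl X X' X'' Y (f' : mor X' X'') (f : mor X X') :
  (f' \oc f) \ox 'id_Y = (f' \ox 'id_Y) \oc (f \ox 'id_Y).
Proof. by rewrite -(tmor_comp tC) (comp1m tC). Qed.

Lemma tmor_compr X X' X'' Y (f' : mor X' X'') (f : mor X X') :
  'id_Y \ox (f' \oc f) = ('id_Y \ox f') \oc ('id_Y \ox f).
Proof. by rewrite -(tmor_comp tC) (comp1m tC). Qed.

Lemma tmor_swap X X' Y Y' (f : mor X X') (g : mor Y Y') :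
  (f \ox 'id_Y') \oc ('id_X \ox g) = ('id_X' \ox g) \oc (f \ox 'id_Y).
Proof. by rewrite -!(tmor_comp tC) !(comp1m tC) !(compm1 tC). Qed.

Lemma iso_mono X Y (f : mor X Y) : iso_mor f -> mono_mor f.
Proof.
move=> [g [gf _]] W u v e.
by rewrite -[u](comp1m tC) -[v](comp1m tC) -gf -!(compA tC) e.
Qed.

Lemma iso_epi X Y (f : mor X Y) : iso_mor f -> epi_mor f.
Proof.
move=> [g [_ fg]] W u v e.
by rewrite -[u](compm1 tC) -[v](compm1 tC) -fg !(compA tC) e.
Qed.

Lemma assoc_iso X Y Z : iso_mor (assoc X Y Z).
Proof. by exists (assocV X Y Z); exact: assocK. Qed.

Lemma iso_tmorl X X' Y (f : mor X X') : iso_mor f -> iso_mor (f \ox 'id_Y).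
Proof.
by move=> [g [gf fg]]; exists (g \ox 'id_Y); split; rewrite -tmor_compl ?gf ?fg (tmor1 tC).
Qed.

Lemma iso_tmorr X X' Y (f : mor X X') : iso_mor f -> iso_mor ('id_Y \ox f).
Proof.
by move=> [g [gf fg]]; exists ('id_Y \ox g); split; rewrite -tmor_compr ?gf ?fg (tmor1 tC).
Qed.

Lemma unit_tmor_inj X Y (f g : mor X Y) : 'id_1 \ox f = 'id_1 \ox g -> f = g.
Proof. by move=> e; apply: (iso_epi (lunit_iso tC X)); rewrite -!(lunit_nat tC) e. Qed.

Lemma tmor_unit_inj X Y (f g : mor X Y) : f \ox 'id_1 = g \ox 'id_1 -> f = g.
Proof. by move=> e; apply: (iso_epi (runit_iso tC X)); rewrite -!(runit_nat tC) e. Qed.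

(** This lemma and the next two are Kelly's: these instances of coherence
    follow from the pentagon and the triangle because tensoring with the unit
    is faithful. *)
Lemma lunit_tensor X Y : lunit (X \ot Y) \oc assoc 1 X Y = lunit X \ox 'id_Y.
Proof.
apply: unit_tmor_inj.
apply: (iso_epi (assoc_iso 1 (1 \ot X) Y)).
apply: (iso_epi (iso_tmorl Y (assoc_iso 1 1 X))).
rewrite tmor_compr -!(compA tC) [_ \oc (assoc _ _ _ \oc _)](compA tC) -(pentagon tC).
rewrite (compA tC) (triangle tC) -(tmor1 tC) -(assoc_nat tC) -(triangle tC).
by rewrite tmor_compl !(compA tC) -(assoc_nat tC).
Qed.

Lemma runit_tensor X Y : runit (X \ot Y) = ('id_X \ox runit Y) \oc assoc X Y 1.
Proof.
apply: tmor_unit_inj; apply: (iso_mono (assoc_iso X Y 1)).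
rewrite -(triangle tC) (compA tC) -(tmor1 tC) (assoc_nat tC) -(compA tC) (pentagon tC).
rewrite !(compA tC) -tmor_compr (triangle tC) tmor_compl (compA tC).
by rewrite (assoc_nat tC).
Qed.

Lemma lunit_runit1 : lunit 1 = runit 1.
Proof.
apply: tmor_unit_inj; rewrite -lunit_tensor -(triangle tC); congr (_ \oc _).
by apply: (iso_mono (lunit_iso tC 1)); rewrite (lunit_nat tC).
Qed.

(** The half of a duality that straightens X -> X X' X -> X. Cyclicity of
    traces rests on this identity for the two objects involved. *)
Definition zigzag X X' (ev : mor (X' \ot X) 1) (coev : mor 1 (X \ot X')) :=
  runit X \oc ('id_X \ox ev) \oc assoc X X' X \oc (coev \ox 'id_X) = lunit X.

(** The trace as an endomorphism of the unit, for a chosen dual. *)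
Definition dtrace X X' (ev : mor (X' \ot X) 1) (coev : mor 1 (X \ot X'))
    (f : mor X X) : mor 1 1 :=
  ev \oc braid X X' \oc (f \ox 'id_X') \oc coev.

(** The transpose of f is the composite
    Y' -> Y' (X X') -> Y' (Y X') -> (Y' Y) X' -> X'
    of coev_X, f and ev_Y. In a strict category both identities would be read
    off from one zigzag identity each: that of Y for the first one, that of X
    for the second. *)
Lemma transpose_exists X Y X' Y' (evX : mor (X' \ot X) 1) (coevX : mor 1 (X \ot X'))
    (evY : mor (Y' \ot Y) 1) (coevY : mor 1 (Y \ot Y')) (f : mor X Y) :
  zigzag evX coevX -> zigzag evY coevY ->
  exists ft : mor Y' X',
    ('id_Y \ox ft) \oc coevY = (f \ox 'id_X') \oc coevX /\
    evX \oc (ft \ox 'id_X) = evY \oc ('id_Y' \ox f).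
Proof.
move=> zX zY.
pose w := (f \ox 'id_X') \oc coevX.
have [rV [rVr rrV]] := runit_iso tC Y'.
have [r1V [r1Vr r1rV]] := runit_iso tC 1.
exists (lunit X' \oc (evY \ox 'id_X') \oc assocV Y' Y X' \oc ('id_Y' \ox w) \oc rV).
split.
- have e1 : ('id_Y \ox rV) \oc coevY = assoc Y Y' 1 \oc (coevY \ox 'id_1) \oc r1V.
    apply: (iso_mono (iso_tmorr Y (runit_iso tC Y'))).
    rewrite (compA tC) -tmor_compr rrV (tmor1 tC) (comp1m tC) !(compA tC).
    by rewrite -runit_tensor (runit_nat tC) -(compA tC) r1rV (compm1 tC).
  have e2 : ('id_Y \ox ('id_Y' \ox w)) \oc (assoc Y Y' 1 \oc (coevY \ox 'id_1)) =
      assoc Y Y' (Y \ot X') \oc (coevY \ox 'id_(Y \ot X')) \oc ('id_1 \ox w).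
    by rewrite (compA tC) -(assoc_nat tC) (tmor1 tC) -!(compA tC) tmor_swap.
  have e3 : ('id_Y \ox assocV Y' Y X') \oc (assoc Y Y' (Y \ot X') \oc (coevY \ox 'id_(Y \ot X')))
      \oc assoc 1 Y X' =
      assoc Y (Y' \ot Y) X' \oc ((assoc Y Y' Y \oc (coevY \ox 'id_Y)) \ox 'id_X').
    apply: (iso_mono (iso_tmorr Y (assoc_iso Y' Y X'))).
    rewrite !(compA tC) -tmor_compr (assocK tC _ _ _).2 (tmor1 tC) (comp1m tC).
    rewrite -(compA tC) -(tmor1 tC Y X') -(assoc_nat tC) (compA tC) (pentagon tC).
    by rewrite tmor_compl !(compA tC).
  have e4 : ('id_Y \ox (lunit X' \oc (evY \ox 'id_X'))) \oc assoc Y (Y' \ot Y) X' =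
      (runit Y \oc ('id_Y \ox evY)) \ox 'id_X'.
    by rewrite tmor_compr -(compA tC) -(assoc_nat tC) (compA tC) (triangle tC) tmor_compl.
  (* The zigzag identity of Y, tensored with X'. *)
  have e5 : ('id_Y \ox (lunit X' \oc (evY \ox 'id_X'))) \oc
      (('id_Y \ox assocV Y' Y X') \oc (assoc Y Y' (Y \ot X') \oc (coevY \ox 'id_(Y \ot X')))) =
      lunit (Y \ot X').
    apply: (iso_epi (assoc_iso 1 Y X')).
    rewrite -(compA tC) e3 (compA tC) e4 -tmor_compl lunit_tensor; congr (_ \ox _).
    by rewrite -zY !(compA tC).
  rewrite -/w (tmor_compr _ _ rV) (tmor_compr _ _ ('id_Y' \ox w)).
  rewrite (tmor_compr _ _ (assocV Y' Y X')) -!(compA tC) e1.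
  rewrite [_ \oc (assoc _ _ _ \oc _ \oc r1V)](compA tC) e2 -!(compA tC).
  rewrite [assoc _ _ _ \oc (_ \oc _)](compA tC) [assocT in _ \oc assocT](compA tC).
  rewrite [X in X = _](compA tC) e5 (compA tC) (lunit_nat tC) -(compA tC).
  by rewrite lunit_runit1 r1rV (compm1 tC).
- have f1 : evX \oc (lunit X' \ox 'id_X) \oc ((evY \ox 'id_X') \ox 'id_X) =
      evY \oc runit (Y' \ot Y) \oc ('id_(Y' \ot Y) \ox evX) \oc assoc (Y' \ot Y) X' X.
    rewrite -lunit_tensor !(compA tC) -(lunit_nat tC) -!(compA tC) (assoc_nat tC) (tmor1 tC).
    rewrite !(compA tC) -(compA tC _ _ (evY \ox _)) -tmor_swap (compA tC) lunit_runit1.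
    by rewrite (runit_nat tC).
  have f2 : runit (Y' \ot Y) \oc ('id_(Y' \ot Y) \ox evX) \oc assoc (Y' \ot Y) X' X
      \oc (assocV Y' Y X' \ox 'id_X) =
      ('id_Y' \ox (runit Y \oc ('id_Y \ox evX) \oc assoc Y X' X)) \oc assoc Y' (Y \ot X') X.
    apply: (iso_epi (iso_tmorl X (assoc_iso Y' Y X'))).
    rewrite -(compA tC) -tmor_compl (assocK tC _ _ _).1 (tmor1 tC) (compm1 tC).
    rewrite runit_tensor -(tmor1 tC) -(compA tC _ _ ((_ \ox _) \ox _)) (assoc_nat tC).
    rewrite -!(compA tC) (pentagon tC) !tmor_compr.
    by rewrite !(compA tC).
  (* The zigzag identity of X, followed by f. *)
  have f3 : runit Y \oc ('id_Y \ox evX) \oc assoc Y X' X \oc (w \ox 'id_X) = f \oc lunit X.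
    rewrite tmor_compl -zX !(compA tC) -(runit_nat tC).
    rewrite -(compA tC _ (assoc _ _ _)) (assoc_nat tC) (tmor1 tC) !(compA tC).
    by rewrite -(compA tC (runit Y) _ (f \ox _)) -tmor_swap !(compA tC).
  have f4 : ('id_Y' \ox lunit X) \oc (assoc Y' 1 X \oc (rV \ox 'id_X)) = 'id_(Y' \ot X).
    by rewrite (compA tC) (triangle tC) -tmor_compl rrV (tmor1 tC).
  rewrite -/w !(tmor_compl X) !(compA tC) f1 -!(compA tC evY) f2.
  rewrite -(compA tC _ (assoc _ _ _)) (assoc_nat tC) (compA tC ('id_Y' \ox _)) -tmor_compr f3.
  by rewrite tmor_compr -!(compA tC) f4 (compm1 tC).
Qed.

(** Slide f along coev_X to its transpose, exchange the two factors by
    naturality of the braiding, and slide the transpose back along ev_X. With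
    g the identity this says that the trace does not depend on the dual. *)
Lemma dtraceC X Y X' Y' (evX : mor (X' \ot X) 1) (coevX : mor 1 (X \ot X'))
    (evY : mor (Y' \ot Y) 1) (coevY : mor 1 (Y \ot Y')) (f : mor X Y) (g : mor Y X) :
  zigzag evX coevX -> zigzag evY coevY ->
  dtrace evX coevX (g \oc f) = dtrace evY coevY (f \oc g).
Proof.
move=> zX zY; have [ft [ftY ftX]] := transpose_exists f zX zY.
rewrite /dtrace !tmor_compl -!(compA tC) -ftY (compA tC _ ('id_Y \ox ft)) tmor_swap.
rewrite !(compA tC) -(compA tC _ (braid X X')) (braid_nat tC) (compA tC) ftX.
by rewrite -(compA tC _ _ (braid _ _)) -(braid_nat tC) !(compA tC).
Qed.

Lemma iter_compS X (f : mor X X) n :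
  iter n.+1 (mcomp f) 'id_X = iter n (mcomp f) 'id_X \oc f.
Proof.
elim: n => [|n IH]; first by rewrite /= (compm1 tC) (comp1m tC).
by rewrite iterS [in LHS]IH (compA tC).
Qed.

(** Induction on the order of nilpotency. Factor f through its image I, the
    kernel of its cokernel, as f = i p. By cyclicity f and the endomorphism
    p i of I have the same trace. The power f^n kills the image of f when
    f^(n+1) = 0, so i (p i)^n = f^n i = 0 and (p i)^n = 0, as i is mono. *)
Lemma nilpotent_dtrace0 n X X' (ev : mor (X' \ot X) 1) (coev : mor 1 (X \ot X'))
    (f : mor X X) :
  abelian_category C -> (forall X, rigid_obj X) -> zigzag ev coev ->
  iter n (mcomp f) 'id_X = 0 -> dtrace ev coev f = 0.
Proof.
move=> aC rC; elim: n X X' ev coev f => [|n IH] X X' ev coev f zX /=.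
  by move=> e; rewrite -[f](compm1 tC) e compm0 /dtrace tmor0l compm0 comp0m.
move=> fn0.
have [Q [q [qf0 qP]]] := has_cokernels aC f.
have [I [i [qi0 iP]]] := has_kernels aC q.
have [p [ipf _]] := iP _ _ qf0.
have [I' [evI [coevI [zI _]]]] := rC I.
rewrite -ipf (dtraceC p i zX zI); apply: IH => //.
have ipow m : i \oc iter m (mcomp (p \oc i)) 'id_I = iter m (mcomp f) 'id_X \oc i.
  elim: m => [|m IHm]; first by rewrite /= (compm1 tC) (comp1m tC).
  by rewrite !iterS !(compA tC) ipf -!(compA tC) IHm.
have i_mono W (h : mor W I) : i \oc h = 0 -> h = 0.
  move=> ih0; have [|u [_ uP]] := iP W 0; first by rewrite compm0.
  by rewrite -(uP h ih0); apply: uP; rewrite compm0.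
apply: i_mono; rewrite ipow.
have [|r [rq _]] := qP _ (iter n (mcomp f) 'id_X); first by rewrite -iter_compS.
by rewrite -rq -(compA tC) qi0 compm0.
Qed.

End Traces.

Section FunctorTrace.
Local Open Scope tensor_scope.
Variables (k : fieldType) (C D : tensor_data k) (tD : tensor_category D).
Variable F : tensor_functor C D.
Local Notation "'id_ X" := (idmor X) (at level 8, X at level 2, format "''id_' X").
Local Notation F_ := (fmor F _ _).

(** The dual is transported along the structure isomorphisms of F: the new
    ev is F ev, precomposed with F X' F X -> F (X' X) and postcomposed with
    F 1 -> 1, and dually for coev. *)
Lemma functor_dtrace (X X' : C) (ev : mor (X' \ot X) (tunit C))
    (coev : mor (tunit C) (X \ot X')) (f : mor X X) (t : k) :
  zigzag ev coev -> dtrace ev coev f = t *: 'id_(tunit C) ->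
  exists ev' coev', @zigzag k D (F X) (F X') ev' coev' /\
    dtrace ev' coev' (F_ f) = t *: 'id_(tunit D).
Proof.
rewrite /zigzag /dtrace => zX trf.
have [m [mr rm]] := ften_iso F X X'.
have [e [er re]] := fun1_iso F.
exists (e \oc F_ ev \oc ften F X' X), (m \oc F_ coev \oc fun1 F); split.
- rewrite /zigzag -(ften_lunit F) -zX !fmor_comp.
  have e1 : runit (F X) \oc ('id_(F X) \ox (e \oc F_ ev)) = F_ (runit X) \oc ften F _ _ \oc ('id_(F X) \ox F_ ev).
    rewrite -(ften_runit F) (tmor_compr tD) (compA tD) -(compA tD _ _ (_ \ox e)).
    by rewrite -(tmor_compr tD) re (tmor1 tD) (compm1 tD).
  rewrite (tmor_compr tD _ (e \oc _)) (compA tD) e1.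
  rewrite -(compA tD (F_ (runit X))) -{1}(fmor1 F) (ften_nat F).
  rewrite !(compA tD) -!(compA tD _ _ (assoc _ _ _)) -!(compA tD _ _ (_ \oc assoc _ _ _)).
  rewrite (compA tD (ften F _ _)) -(ften_assoc F).
  rewrite !(tmor_compl tD) !(compA tD) -(compA tD _ (ften F X X' \ox _)) -(tmor_compl tD).
  rewrite rm (tmor1 tD) (compm1 tD).
  have e2 : ften F _ _ \oc (F_ coev \ox 'id_(F X)) = F_ (coev \ox 'id_X) \oc ften F _ _.
    by rewrite -(fmor1 F) (ften_nat F).
  by rewrite -(compA tD _ (ften F _ _)) e2 !(compA tD).
- rewrite /dtrace -!(compA tD) (compA tD (ften F X' X)) -(ften_braid F).
  rewrite -!(compA tD) (compA tD _ (F_ f \ox _)) -(fmor1 F) (ften_nat F).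
  rewrite -!(compA tD) (compA tD _ m) rm (comp1m tD).
  have eF : F_ ev \oc F_ (braid X X') \oc F_ (f \ox 'id_X') \oc F_ coev =
      t *: 'id_(F (tunit C)) by rewrite -!fmor_comp trf linearZ /= fmor1.
  have -> r : F_ ev \oc (F_ (braid X X') \oc (F_ (f \ox 'id_X') \oc (F_ coev \oc r))) =
      t *: 'id_(F (tunit C)) \oc r :> mor (tunit D) _ by rewrite -eF !(compA tD).
  by rewrite (compZl tD) (comp1m tD) (compZr tD) er.
Qed.

End FunctorTrace.

Lemma functor_iter_comp (k : fieldType) (C D : tensor_data k) (F : tensor_functor C D)
    (X : C) (f : mor X X) n :
  fmor F X X (iter n (mcomp f) (idmor X)) = iter n (mcomp (fmor F X X f)) (idmor (F X)).
Proof. by elim: n => [|n IH]; rewrite ?fmor1 // iterS fmor_comp IH. Qed.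

(** A functor maps f to a nilpotent endomorphism whose trace is t times the
    identity of the unit, so that t = 0. *)
Lemma no_functor_to_pre_tannakian (k : fieldType) (C D : tensor_data k)
    (X : C) (f : mor X X) (t : k) :
  nilpotent_mor f -> is_trace f t -> t <> 0 -> pre_tannakian D -> tensor_functor C D ->
  False.
Proof.
move=> [n fn0] [X' [ev [coev [[zX _] trf]]]] t0 ptD F; apply: t0.
have [tD aD _ _ rD bD] := ptD.
have [ev' [coev' [zF trF]]] := functor_dtrace tD F zX trf.
apply: (bij_inj bD); rewrite -trF scale0r.
by apply: (@nilpotent_dtrace0 _ _ tD n) => //; rewrite -functor_iter_comp fn0 linear0.
Qed.

(** * Alternating sums over finite sets *)

Section AlternatingSums.
Variable R : comNzRingType.

Lemma alternating_subset_sum (D : finType) (U : {set D}) :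
  \sum_(S : {set D} | S \subset U) (-1) ^+ #|S| = (U == finset.set0)%:R :> R.
Proof.
pose F (i : D) : R := if i \in U then -1 else 0.
have : \prod_i (F i + 1) = \sum_(S in {set D}) \prod_i (if i \in S then F i else 1).
  exact: bigA_distr.
have -> : \sum_(S in {set D}) \prod_i (if i \in S then F i else 1) =
    \sum_(S : {set D} | S \subset U) (-1) ^+ #|S|.
  rewrite (bigID (fun S : {set D} => S \subset U))/= [X in _ + X]big1 ?addr0.
    apply: eq_bigr => S SU; rewrite -big_mkcond/= -prodr_const.
    by apply: eq_bigr => i iS; rewrite /F (fintype.subsetP SU).
  move=> S /subsetPn[i iS iU].
  by rewrite (bigD1 i)//= iS /F (negbTE iU) mul0r.
move=> <-; have [U0|/finset.set0Pn[i iU]] := eqVneq.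
  by rewrite big1// => i _; rewrite /F U0 inE add0r.
by rewrite (bigD1 i)//= /F iU addNr mul0r.
Qed.

(** Call g(Q) the left-hand side. Summing g over all subsets of Q gives the
    alternating sum over the subsets S of U lying over Q, which is 0 unless Q
    is empty, as Q is contained in h(U). The function Q |-> (-1)^|Q| has the
    same sums over subsets, so that the two agree by induction on Q. *)
Lemma alternating_image_sum (D E : finType) (h : D -> E) (U : {set D}) (Q : {set E}) :
  Q \subset h @: U ->
  \sum_(S : {set D} | (S \subset U) && (h @: S == Q)) (-1) ^+ #|S| =
    (-1) ^+ #|Q| :> R.
Proof.
have [n] := ubnP #|Q|; elim: n Q => // n IH Q cQ QU.
have : \sum_(Q' : {set E} | Q' \subset Q)
    \sum_(S : {set D} | (S \subset U) && (h @: S == Q')) (-1) ^+ #|S| =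
    \sum_(Q' : {set E} | Q' \subset Q) (-1) ^+ #|Q'| :> R.
  rewrite alternating_subset_sum.
  transitivity (\sum_(S : {set D} | S \subset U :&: h @^-1: Q) (-1) ^+ #|S| : R).
    rewrite [RHS](partition_big (fun S : {set D} => h @: S) (fun Q' => Q' \subset Q))/=.
      apply: eq_bigr => Q' Q'Q; apply: eq_bigl => S; rewrite finset.subsetI.
      case: (h @: S =P Q') => [e|_]; last by rewrite !andbF.
      by rewrite -sub_imset_pre e Q'Q !andbT.
    by move=> S; rewrite finset.subsetI => /andP[_]; rewrite sub_imset_pre.
  rewrite alternating_subset_sum; congr (nat_of_bool _)%:R.
  apply/eqP/eqP => [e|->]; last by rewrite preimset0 finset.setI0.
  apply/eqP; rewrite -finset.subset0; apply/fintype.subsetP => q qQ.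
  have /imsetP[x xU qE] := fintype.subsetP QU q qQ.
  have : x \in U :&: h @^-1: Q by rewrite !inE xU -qE.
  by rewrite e inE.
rewrite (bigD1 Q)//= [RHS](bigD1 Q)//= => e; apply: (addIr _ (etrans e _)).
congr (_ + _); apply: eq_bigr => Q' /andP[Q'Q ne].
rewrite IH//; last exact: fintype.subset_trans QU.
by rewrite -ltnS (leq_trans _ cQ)// ltnS proper_card// finset.properEneq ne.
Qed.

End AlternatingSums.

(** * Orbits *)

Lemma bij_of_inj_surj (A B : Type) (f : A -> B) :
  injective f -> (forall y, exists x, f x = y) -> bijective f.
Proof.
move=> fi /choice[g gP]; exists g => // x.
by apply: fi; rewrite gP.
Qed.

Section Orbits.
Variable T : topologicalType.

Lemma gmap_eq (X Y : gset T) (f g : gmap X Y) : f =1 g -> f = g.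
Proof.
case: f g => [f fP] [g gP] /= /funext e; rewrite -{g}e in gP *.
congr GMap; exact: Prop_irrelevance.
Qed.

Definition orbit_of (X : gset T) (x : X) : gorbit X :=
  SigSub (mem_set (imageT (@orbit_set T X) x)).

Lemma mem_orbit_of (X : gset T) (x : X) : val (orbit_of x) x.
Proof. by exists 1%g; rewrite act1. Qed.

Lemma mem_orbit (X : gset T) (W : gorbit X) x y :
  val W x -> val W y <-> exists g, y = gact g x.
Proof.
have [w _ <-] := set_mem (valP W) => -[g ->]; split=> -[h ->].
  by exists (h * g^-1)%g; rewrite actM actK.
by exists (h * g)%g; rewrite actM.
Qed.

Lemma orbit_ofP (X : gset T) (W : gorbit X) x : val W x -> W = orbit_of x.
Proof.
move=> Wx; apply: val_inj; rewrite eqEsubset; split=> y /=.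
  by move=> /(mem_orbit _ Wx).
by move=> /(mem_orbit _ Wx).
Qed.

Lemma orbit_reprP (X : gset T) (W : gorbit X) : val W (orbit_repr W).
Proof. by rewrite /orbit_repr; case: cid. Qed.

Lemma finite_orbits (X : fgset T) (P : set (gorbit X)) : finite_set P.
Proof.
have [n [s sP]] := fgP X.
apply: (@sub_finite_set _ _ ((fun i => orbit_of (s i)) @` [set: 'I_n])%classic).
  move=> W _ /=; have [i [g e]] := sP (orbit_repr W).
  exists i => //; apply/esym/orbit_ofP.
  by apply/(mem_orbit _ (orbit_reprP W)); exists g^-1%g; rewrite e actK.
exact/finite_image/finite_finset.
Qed.

Lemma orbit_transitive (X : fgset T) (W : gorbit X) : transitive_gset (orbit_fgset W).
Proof.
exists (SigSub (mem_set (orbit_reprP W))) => y.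
have [g yE] := (mem_orbit _ (orbit_reprP W)).1 (set_mem (valP y)).
by exists g; apply: val_inj.
Qed.

Lemma unit_transitive : transitive_gset (fgset1 T).
Proof. by exists tt => -[]; exists 1%g. Qed.

End Orbits.

(** * G-sets of locally constant maps *)

Section LocallyConstantMaps.
Variable T : cantorSpace.

Definition locally_constant (D : Type) (p : T -> D) := forall t, \forall s \near t, p s = p t.

Lemma locally_constant_comp (D E : Type) (h : D -> E) (p : T -> D) :
  locally_constant p -> locally_constant (h \o p).
Proof. by move=> pc t; apply: filterS (pc t) => s /= ->. Qed.

Lemma cantor_inhabited : inhabited T.
Proof. by have [f [g _]] := cantor_sortP T; constructor; exact: g (fun=> true). Qed.

(** A point of the Cantor space is sent to the element of S indexed by the
    position of its first true bit among the first |S| ones, and to a fixed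
    element of S if there is no such bit. *)
Lemma exists_locally_constant (D : finType) (S : {set D}) : S != finset.set0 ->
  exists p : T -> D, locally_constant p /\ forall d, d \in S <-> exists t, p t = d.
Proof.
move=> /finset.set0Pn[d0 d0S]; have [f [g [fK gK]]] := cantor_sortP T.
pose q (x : cantor_space) := nth d0 (enum S) (find (fun i => x i) (iota 0 #|S|)).
exists (q \o f); split=> [t|d].
  have : \forall s \near t, forall i, (i < #|S|)%N -> f s i = f t i.
    exact: (@cts_fun _ _ f t _ (cantor_near #|S| (f t))).
  apply: filterS => s e /=; congr nth; apply: eq_in_find => i.
  by rewrite mem_iota add0n => /e.
split=> [dS|[t <-]].
  pose i := index d (enum S).
  have iS : (i < #|S|)%N by rewrite cardE index_mem mem_enum.
  exists (g (fun j => j == i)); rewrite /= gK /q.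
  have -> : find (fun j => j == i) (iota 0 #|S|) = i.
    by have := @index_uniq _ 0 i (iota 0 #|S|); rewrite size_iota nth_iota//; apply=> //; exact: iota_uniq.
  by rewrite nth_index// mem_enum.
rewrite /= /q; set i := find _ _.
have [lt|ge] := ltnP i #|S|; last by rewrite nth_default// -cardE.
by rewrite -mem_enum mem_nth// -cardE.
Qed.
End LocallyConstantMaps.

(** An identification of X with the G-set of all locally constant maps to D.
    For D = 'I_n this is the G-set of all continuous maps to n points; other
    index types are needed because a product of two such G-sets is coded by
    pairs. *)
Record map_coding (T : cantorSpace) (X : gset T) (D : finType) := MapCoding {
  code :> X -> T -> D;
  code_locally_constant : forall x, locally_constant (code x);
  code_act : forall g x t, code (gact g x) t = code x (hinv g t);
  code_inj : forall x y, code x =1 code y -> x = y;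
  code_surj : forall p, locally_constant p -> exists x, code x =1 p }.

Section Codings.
Variable T : cantorSpace.

Lemma Y_code_surj n (p : T -> 'I_n) :
  locally_constant p -> exists x : Y_fgset T n, (x : continuousType _ _) =1 p.
Proof.
move=> pc.
have cp : continuous (p : T -> discrete_topology 'I_n).
  move=> t U /nbhs_singleton pU.
  by apply: filterS (pc t) => s /= e; rewrite /= e.
by exists (mkcts cp : continuousType T (discrete_topology 'I_n)).
Qed.

Definition Y_coding n : map_coding (Y_fgset T n) 'I_n :=
  @MapCoding T (Y_fgset T n) 'I_n (fun p t => (p : continuousType _ _) t)
    (@map_near T n) (fun _ _ _ => erefl) (fun p q e => (continuousEP p q).2 e)
    (@Y_code_surj n).

Program Definition unit_coding : map_coding (fgset1 T) unit :=
  @MapCoding T (fgset1 T) unit (fun _ _ => tt) _ _ _ _.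
Next Obligation. by move=> x t; apply: filterE. Qed.
Next Obligation. by []. Qed.
Next Obligation. by case=> -[]. Qed.
Next Obligation. by move=> p _; exists tt => t; case: (p t). Qed.

Program Definition prod_coding (X Y : fgset T) (D E : finType) (c : map_coding X D)
    (d : map_coding Y E) : map_coding (prod_fgset X Y) (D * E)%type :=
  @MapCoding T (prod_fgset X Y) (D * E)%type (fun z t => (c z.1 t, d z.2 t)) _ _ _ _.
Next Obligation.
move=> X Y D E c d z t.
by apply: filterS2 (code_locally_constant c z.1 t) (code_locally_constant d z.2 t) => s /= -> ->.
Qed.
Next Obligation. by move=> X Y D E c d g z t /=; rewrite !code_act. Qed.
Next Obligation.
move=> X Y D E c d [x y] [x' y'] /= e; congr pair.
  by apply: (code_inj (m := c)) => t; case: (e t).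
by apply: (code_inj (m := d)) => t; case: (e t).
Qed.
Next Obligation.
move=> X Y D E c d p pc.
have [x xP] := code_surj c (locally_constant_comp fst pc).
have [y yP] := code_surj d (locally_constant_comp snd pc).
by exists (x, y) => t /=; rewrite xP yP /=; case: (p t).
Qed.
End Codings.

Section CodeRange.
Variables (T : cantorSpace) (X : fgset T) (D : finType) (c : map_coding X D).

(** The image of the coded map; by homogeneity of the Cantor space it
    determines the orbit of x, and any non-empty subset of D occurs. *)
Definition code_range (x : X) : {set D} := [set d | `[< exists t, c x t = d >]]%SET.

Lemma code_rangeP x d : reflect (exists t, c x t = d) (d \in code_range x).
Proof. by rewrite inE; exact: asboolP. Qed.

Lemma mem_code_range x t : c x t \in code_range x.
Proof. by apply/code_rangeP; exists t. Qed.

Lemma code_range_act g x : code_range (gact g x) = code_range x.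
Proof.
apply/setP => d; apply/code_rangeP/code_rangeP => -[t <-].
  by exists (hinv g t); rewrite code_act.
by exists (g t); rewrite code_act hfunK.
Qed.

Lemma code_range_neq0 x : code_range x != finset.set0.
Proof.
by have [t] := cantor_inhabited T; apply/finset.set0Pn; exists (c x t); exact: mem_code_range.
Qed.

Lemma code_range_onto S : S != finset.set0 -> exists x, code_range x = S.
Proof.
move=> /(exists_locally_constant T)[p [pc pS]].
have [x xp] := code_surj c pc; exists x; apply/setP => d.
by apply/code_rangeP/idP => [[t <-]|/pS[t <-]]; [apply/pS|]; exists t; rewrite xp.
Qed.

Lemma code_range_orbit x y : code_range x = code_range y -> exists g, y = gact g x.
Proof.
move=> e; have [|||g gP] := @cantor_homogeneous T D (c y) (c x).
- exact: code_locally_constant.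
- exact: code_locally_constant.
- rewrite eqEsubset; split => d [t _ td].
    have /code_rangeP[s <-] : d \in code_range x by rewrite e -td mem_code_range.
    by exists s.
  have /code_rangeP[s <-] : d \in code_range y by rewrite -e -td mem_code_range.
  by exists s.
- exists g^-1%g; apply: (code_inj (m := c)) => t.
  by rewrite code_act -gP.
Qed.

Lemma mem_orbitP (W : gorbit X) x : val W x <-> code_range x = code_range (orbit_repr W).
Proof.
split=> [|/esym/code_range_orbit] /(mem_orbit _ (orbit_reprP W)) // [g ->].
exact: code_range_act.
Qed.

Lemma orbit_eq (V W : gorbit X) :
  code_range (orbit_repr V) = code_range (orbit_repr W) -> V = W.
Proof.
move=> e; apply: val_inj; rewrite eqEsubset; split => x; rewrite /= !mem_orbitP.
  by rewrite e.
by rewrite e.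
Qed.

End CodeRange.

Lemma code_range_map (T : cantorSpace) (X Y : fgset T) (D E : finType)
    (c : map_coding X D) (d : map_coding Y E) (f : X -> Y) (h : D -> E) :
  (forall x t, d (f x) t = h (c x t)) ->
  forall x, code_range d (f x) = h @: code_range c x.
Proof.
move=> fh x; apply/setP => e; apply/code_rangeP/imsetP.
  by move=> [t <-]; exists (c x t); rewrite ?mem_code_range.
by move=> [_ /code_rangeP[t <-] ->]; exists t.
Qed.

(** * The measure and the push-forward *)

Section Measure.
Variables (T : cantorSpace) (nu : gmeasure T rat).
Hypothesis nuX : forall n : nat, (1 <= n)%N -> gmu_obj nu (X_fgset T n) = (-1) ^+ n.-1.

Lemma gmu_obj_iso (X Y : fgset T) (f : gmap X Y) :
  transitive_gset Y -> bijective f -> gmu_obj nu X = gmu_obj nu Y.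
Proof.
move=> trY bf; rewrite /gmu_obj.
rewrite (_ : to1 X = gmap_comp (to1 Y) f); last by apply: gmap_eq.
by rewrite (gmu_comp nu _ _ trY (unit_transitive T)) (gmu_iso nu trY bf) mulr1.
Qed.

(** Numbering the image S of the coded maps identifies W with X(|S|). *)
Lemma gmu_orbit (X : fgset T) (D : finType) (c : map_coding X D) (W : gorbit X) :
  gmu_obj nu (orbit_fgset W) = (-1) ^+ #|code_range c (orbit_repr W)|.-1.
Proof.
set S := code_range _ _.
have S0 : (0 < #|S|)%N by rewrite card_gt0; exact: code_range_neq0.
pose ev (p : X_fgset T #|S|) (t : T) := (val p : continuousType T (discrete_topology 'I_#|S|)) t.
have ex (p : X_fgset T #|S|) : exists x : orbit_fgset W, forall t, c (val x) t = enum_val (ev p t).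
  have pc : locally_constant (fun t => enum_val (ev p t)).
    by apply: (locally_constant_comp (fun i : 'I_#|S| => enum_val i)); exact: map_near.
  have [x xP] := code_surj c pc.
  have Wx : val W x.
    apply/(mem_orbitP c)/setP => d; apply/code_rangeP/idP => [[t <-]|dS].
      by rewrite xP enum_valP.
    have [t tP] := set_mem (valP p) (enum_rank_in dS d).
    by exists t; rewrite xP /ev tP enum_rankK_in.
  by exists (SigSub (mem_set Wx)).
have [phi phiP] := choice ex.
have phi_act g p : phi (gact g p) = gact g (phi p).
  by apply: val_inj; apply: (code_inj (m := c)) => t; rewrite phiP /= code_act phiP.
rewrite -(nuX S0); apply/esym/(gmu_obj_iso (f := GMap phi_act) (orbit_transitive W)).
apply: bij_of_inj_surj => [p q e|x].
  apply: val_inj; apply/continuousEP => t; apply: enum_val_inj.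
  by rewrite -[LHS]phiP -[RHS]phiP [phi p]e.
have xS : code_range c (val x) = S by apply/mem_orbitP; exact: set_mem (valP x).
have [t0] := cantor_inhabited T.
have t0S : c (val x) t0 \in S by rewrite -xS mem_code_range.
have [p pP] := Y_code_surj (locally_constant_comp (enum_rank_in t0S)
  (code_locally_constant c (val x))).
have p_surj i : exists t, (p : continuousType _ _) t = i.
  have /code_rangeP[t tP] : enum_val i \in code_range c (val x) by rewrite xS enum_valP.
  by exists t; rewrite pP /= tP enum_valK_in.
exists (SigSub (mem_set p_surj)); apply: val_inj; apply: (code_inj (m := c)) => t.
by rewrite phiP /ev /= pP /= enum_rankK_in// -xS mem_code_range.
Qed.

(** By multiplicativity, the measure of W -> f(W) is the quotient of the
    measures of W and f(W), which are signs. *)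
Lemma gmu_orbit_gmap (X Y : fgset T) (D E : finType) (c : map_coding X D)
    (d : map_coding Y E) (f : gmap X Y) (h : D -> E) (W : gorbit X) :
  (forall x t, d (f x) t = h (c x t)) ->
  gmu nu (orbit_gmap f W) =
    (-1) ^+ (#|code_range c (orbit_repr W)| + #|h @: code_range c (orbit_repr W)|).
Proof.
move=> fh; set S := code_range _ _.
have := @gmu_comp _ _ nu _ _ (fgset1 T) (to1 (orbit_fgset (image_orbit f W)))
  (orbit_gmap f W) (orbit_transitive _) (unit_transitive T).
rewrite (_ : gmap_comp _ _ = to1 (orbit_fgset W)); last exact: gmap_eq.
rewrite -/(gmu_obj nu _) (gmu_orbit c) -/(gmu_obj nu _) (gmu_orbit d) -/S.
have -> : code_range d (orbit_repr (image_orbit f W)) = h @: S.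
  rewrite -(code_range_map (c := c) fh); apply/esym/mem_orbitP.
  by exists (orbit_repr W) => //; exact/(mem_orbitP c).
have : (0 < #|S|)%N by rewrite card_gt0; exact: code_range_neq0.
have : (0 < #|h @: S|)%N by rewrite card_gt0 -(code_range_map (c := c) fh); exact: code_range_neq0.
case: #|S| => // a; case: #|_ @: _| => // b _ _ /= e.
by rewrite -(signrMK b (gmu _ _)) -e addSn addnS !exprS !mulN1r opprK exprD mulrC.
Qed.

Variable k : fieldType.

Lemma ratr_sign n : ratr ((-1) ^+ n) = (-1) ^+ n :> k.
Proof.
by rewrite -[in LHS]signr_odd -[in RHS]signr_odd; case: (odd n); rewrite /ratr /= ?divr1.
Qed.

(** For non-empty U these functions form a basis of the invariant functions.
    It is better suited than the indicators of orbits, because push-forwards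
    send one basis vector to another, without coefficients. *)
Program Definition range_within (X : fgset T) (D : finType) (c : map_coding X D)
    (U : {set D}) : inv_fun k X :=
  @mk_inv_fun k T X (fun x => (code_range c x \subset U)%:R) _.
Next Obligation. by move=> X D c U g x /=; rewrite code_range_act. Qed.

(** The fibre over y meets one orbit for each S with h(S) equal to the range Q
    of y. The value at y is thus the sum of (-1)^(|S| + |Q|) over the S
    contained in U with h(S) = Q, which is 1 or 0 according to whether Q is
    contained in h(U) or not. *)
Lemma pushforward_range_within (X Y : fgset T) (D E : finType) (c : map_coding X D)
    (d : map_coding Y E) (f : gmap X Y) (h : D -> E) (U : {set D}) :
  (forall x t, d (f x) t = h (c x t)) ->
  inv_pushforward nu f (range_within c U) = range_within d (h @: U).
Proof.
move=> fh; apply: val_inj; apply/funext => y /=.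
pose rW (W : gorbit X) := code_range c (orbit_repr W).
have fP (W : gorbit X) : (f @` val W)%classic y <-> h @: rW W = code_range d y.
  split=> [[x Wx <-]|].
    by rewrite (code_range_map (c := c) fh) ((mem_orbitP c W x).1 Wx).
  rewrite /rW -(code_range_map (c := c) fh) => /code_range_orbit[g ->].
  exists (gact g (orbit_repr W)); last by rewrite gmapP.
  by apply/(mem_orbitP c); rewrite code_range_act.
under eq_fsbigr => W _ do rewrite (gmu_orbit_gmap W fh) ratr_sign -/(rW W).
have [yU|yU] := boolP (code_range d y \subset h @: U); last first.
  rewrite fsbig1// => W /= /fP WP; rewrite [_ \subset _](_ : _ = false) ?mul0r//.
  by apply/negP => WU; move: yU; rewrite -WP imsetS.
pose G (S : {set D}) : k := (S \subset U)%:R * (-1) ^+ (#|S| + #|code_range d y|).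
transitivity (\sum_(S \in [set S : {set D} | h @: S == code_range d y]%classic) G S).
  rewrite (@reindex_fsbig _ _ _ _ _ rW [set W | (f @` val W)%classic y]%classic).
    by apply: eq_fsbigr => W; rewrite inE => /fP; rewrite /G => ->.
  split.
  - by move=> W /= /fP ->.
  - by move=> V W _ _ /orbit_eq.
  - move=> S /= /eqP SP.
    have [|x xS] := @code_range_onto _ _ _ c S.
      by apply: contraNneq (code_range_neq0 d y) => S0; rewrite -SP S0 imset0.
    have xW : rW (orbit_of x) = S.
      by rewrite -xS; apply/esym/(mem_orbitP c); exact: mem_orbit_of.
    by exists (orbit_of x) => //; apply/fP; rewrite xW.
rewrite -(bigfs _ (r := index_enum _)) ?index_enum_uniq//; last first.
  by move=> S _; rewrite mem_index_enum.
rewrite (bigID (fun S : {set D} => S \subset U))/= [X in _ + X]big1 ?addr0; last first.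
  by move=> S /andP[_ /negbTE SU]; rewrite /G SU mul0r.
rewrite (eq_bigr (fun S : {set D} => (-1) ^+ #|code_range d y| * (-1) ^+ #|S|)).
  rewrite -big_distrr/= (eq_bigl _ _ (fun S => andbC _ _)) alternating_image_sum//.
  by rewrite -expr2 sqrr_sign.
by move=> S /andP[_ SU]; rewrite /G SU mul1r exprD mulrC.
Qed.
End Measure.

(** * Matrix products and duality *)

Section Matrices.
Variables (k : fieldType) (T : cantorSpace) (nu : gmeasure T rat).
Implicit Types X Y Z : fgset T.
Local Notation "X ** Y" := (prod_fgset X Y) (at level 39, left associativity).
Local Notation "B *M A" := (mxmul nu B A) (at level 40, left associativity).

Lemma inv_fun_eq (X : gset T) (f g : inv_fun k X) : f =1 g -> f = g.
Proof. by move=> /funext e; exact: val_inj. Qed.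

Lemma inv_fun_scaleDE (X : gset T) a (f g : inv_fun k X) x :
  (a *: f + g) x = (a : k) * f x + g x.
Proof. by []. Qed.

Lemma pushforward_linear X Y (f : gmap X Y) : linear (@inv_pushforward k T nu X Y f).
Proof.
move=> a phi psi; apply: inv_fun_eq => y; rewrite inv_fun_scaleDE /=.
rewrite mulr_fsumr -fsbig_split /=; last exact: finite_orbits.
apply: eq_fsbigr => W _.
have E (u v r : k) : (a * u + v) * r = a * (u * r) + v * r by rewrite mulrDl mulrA.
exact: E.
Qed.

(** If phi vanishes on the fibre of f x0 except at x0, then f is injective on
    the orbit of x0 (or phi x0 = 0), and that orbit has measure 1 over its
    image. *)
Lemma pushforward_single X Y (f : gmap X Y) (phi : inv_fun k X) (x0 : X) :
  (forall x, f x = f x0 -> x <> x0 -> phi x = 0) ->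
  inv_pushforward nu f phi (f x0) = phi x0.
Proof.
move=> phi0; rewrite /=.
have phiW (W : gorbit X) x : val W x -> phi (orbit_repr W) = phi x.
  by move=> /(mem_orbit _ (orbit_reprP W))[g ->]; rewrite inv_funE.
rewrite (fsbigE [:: orbit_of x0])//=; first last.
- move=> W [x Wx fx]; rewrite inE => /eqP nW; rewrite (phiW W x Wx) phi0 ?mul0r// => e.
  by apply: nW; rewrite -e; exact: orbit_ofP.
- by move=> W /=; rewrite inE => /eqP ->; exists x0 => //; exact: mem_orbit_of.
rewrite big_cons big_nil addr0 ifT; last first.
  by rewrite inE; exists x0 => //; exact: mem_orbit_of.
rewrite (phiW _ x0); last exact: mem_orbit_of.
have [->|nz] := eqVneq (phi x0) 0; first by rewrite mul0r.
rewrite gmu_iso; first by rewrite /ratr /= divr1 mulr1.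
  exact: orbit_transitive.
apply: bij_of_inj_surj => [u v e|y].
  apply: val_inj; have [g ug] := set_mem (valP u); have [h vh] := set_mem (valP v).
  have {e} : f (val u) = f (val v) by exact: (congr1 val e).
  rewrite ug vh !gmapP => e; have [//|ne] := pselect (gact g x0 = gact h x0).
  have e' : f (gact (g^-1 * h)%g x0) = f x0 by rewrite gmapP actM -e actK.
  have ne' : gact (g^-1 * h)%g x0 <> x0.
    by move=> E; apply: ne; rewrite -[in LHS]E actM actKV.
  by case/eqP: nz; rewrite -(inv_funE phi (g^-1 * h)%g); exact: phi0.
have [x Wx xy] := set_mem (valP y).
by exists (SigSub (mem_set Wx)); apply: val_inj.
Qed.

(** In products with graphs of maps and with diagonals, the integration over y
    reduces to a single point. *)
Lemma mxmul_single X Y Z (B : mx k Y Z) (A : mx k X Y) z x y0 :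
  (forall y, y <> y0 -> (B (z, y) : k) * A (y, x) = 0) ->
  (B *M A) (z, x) = (B (z, y0) : k) * A (y0, x).
Proof.
move=> H; apply: (pushforward_single (f := proj13 Z Y X) (x0 := (z, (y0, x)))).
move=> [z' [y x']] /= [-> ->] ne; apply: H => e.
by apply: ne; rewrite e.
Qed.

Lemma mxmul_graph X Y Z (B : mx k Y Z) (f : gmap X Y) z x :
  (B *M graph_mx k f) (z, x) = B (z, f x).
Proof.
rewrite (mxmul_single (y0 := f x)) /= ?asboolT ?mulr1// => y ne.
by rewrite asboolF// mulr0.
Qed.

Lemma graph_mxmul X Y Z (f : gmap Y Z) (g : Z -> Y) (A : mx k X Y) z x :
  cancel f g -> cancel g f -> (graph_mx k f *M A) (z, x) = A (g z, x).
Proof.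
move=> fK gK; rewrite (mxmul_single (y0 := g z)) /= ?gK ?asboolT ?mul1r// => y ne.
by rewrite asboolF ?mul0r// => e; apply: ne; rewrite e fK.
Qed.

(** The evaluation and coevaluation of the self-duality of Vec_X are the
    indicator of the diagonal. *)
Program Definition diag_ev X : mx k (X ** X) (fgset1 T) :=
  @mk_inv_fun k T (fgset1 T ** (X ** X)) (fun p => (`[< p.2.1 = p.2.2 >])%:R) _.
Next Obligation.
move=> X g [_ [x y]] /=; congr (nat_of_bool _)%:R; apply/asbool_equiv_eq.
by split => [/(can_inj (actK g))|->].
Qed.

Program Definition diag_coev X : mx k (fgset1 T) (X ** X) :=
  @mk_inv_fun k T ((X ** X) ** fgset1 T) (fun p => (`[< p.1.1 = p.1.2 >])%:R) _.
Next Obligation.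
move=> X g [[x y] _] /=; congr (nat_of_bool _)%:R; apply/asbool_equiv_eq.
by split => [/(can_inj (actK g))|->].
Qed.

Lemma asbool_natM (P Q : Prop) :
  (`[< P >])%:R * (`[< Q >])%:R = (`[< P /\ Q >])%:R :> k.
Proof. by rewrite -natrM mulnb -asbool_and. Qed.

Lemma asbool_natF (P : Prop) : ~ P -> (`[< P >])%:R = 0 :> k.
Proof. by move=> /asboolF ->. Qed.

Lemma diag_dual X : @is_dual k (Perm k nu) X X (diag_ev X) (diag_coev X).
Proof.
split; apply: inv_fun_eq => -[x].
- pose B := (graph_mx k (grunit X) *M kronecker (graph_mx k (gmap_id X)) (diag_ev X))
    *M graph_mx k (gassoc X X X).
  have BE (y : X ** X ** X) :
      B (x, y) = (`[< x = y.1.1 >])%:R * (`[< y.1.2 = y.2 >])%:R.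
    by rewrite mxmul_graph (graph_mxmul (g := fun y : X => (y, tt) : X ** fgset1 T)) // => -[? []].
  move=> [[] d]; rewrite [LHS](@mxmul_single _ ((X ** X) ** X) X B _ _ _ ((x, x), x)).
    by rewrite (BE (x, x, x)) /= !(asboolT (erefl _)) !mul1r.
  move=> [[a b] c] ne; rewrite (BE (a, b, c)) /= !asbool_natM; apply: asbool_natF => -[[xa bc] [ab _]].
  by apply: ne; rewrite -bc -ab -xa.
- pose B := (graph_mx k (glunit X) *M kronecker (diag_ev X) (graph_mx k (gmap_id X)))
    *M graph_mx k (gassocV X X X).
  have BE (y : X ** (X ** X)) :
      B (x, y) = (`[< y.1 = y.2.1 >])%:R * (`[< x = y.2.2 >])%:R.
    by rewrite mxmul_graph (graph_mxmul (g := fun y : X => (tt, y) : fgset1 T ** X)) // => -[[]].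
  move=> [d []]; rewrite [LHS](@mxmul_single _ (X ** (X ** X)) X B _ _ _ (x, (x, x))).
    by rewrite (BE (x, (x, x))) /= !(asboolT (erefl _)) !mul1r mulr1.
  move=> [a [b c]] ne; rewrite (BE (a, (b, c))) /= !asbool_natM; apply: asbool_natF => -[[ab xc] [_ bc]].
  by apply: ne; rewrite ab bc xc.
Qed.

HB.instance Definition _ X Y (f : gmap X Y) :=
  GRing.isLinear.Build k (inv_fun k X) (inv_fun k Y) *:%R (inv_pushforward nu f)
    (@pushforward_linear X Y f).

Lemma mxmul_subl X Y Z (B B' : mx k Y Z) (A : mx k X Y) :
  (B - B') *M A = B *M A - B' *M A.
Proof.
rewrite /mxmul -raddfB; congr inv_pushforward.
by apply: inv_fun_eq => p; exact: mulrBl.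
Qed.

Lemma mxmul_subr X Y Z (B : mx k Y Z) (A A' : mx k X Y) :
  B *M (A - A') = B *M A - B *M A'.
Proof.
rewrite /mxmul -raddfB; congr inv_pushforward.
by apply: inv_fun_eq => p; exact: mulrBr.
Qed.

(** The composite of two relations, written as the image under the projection
    (z, y, x) |-> (z, x) that defines the product of matrices. *)
Definition rel_comp (D E F : finType) (S : {set F * E}) (R : {set E * D}) : {set F * D} :=
  [set (t.1, t.2.2) | t in [set t : F * (E * D) | ((t.1, t.2.1) \in S) && (t.2 \in R)]]%SET.

Hypothesis nuX : forall n : nat, (1 <= n)%N -> gmu_obj nu (X_fgset T n) = (-1) ^+ n.-1.

Lemma range_withinE (X : fgset T) (D : finType) (c : map_coding X D) (U : {set D}) x :
  range_within k c U x = (`[< forall t, c x t \in U >])%:R.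
Proof.
rewrite /=; congr (nat_of_bool _)%:R; apply/fintype.subsetP/asboolP => [H t|H d].
  by apply: H; exact: mem_code_range.
by move=> /code_rangeP[t <-].
Qed.

(** For X = Y = Z, the indicator matrices thus span a copy of the monoid
    algebra of binary relations, modulo the empty relation. *)
Lemma mxmul_range_within X Y Z (D E F : finType) (c : map_coding X D) (d : map_coding Y E)
    (e : map_coding Z F) (S : {set F * E}) (R : {set E * D}) :
  range_within k (prod_coding e d) S *M range_within k (prod_coding d c) R =
  range_within k (prod_coding e c) (rel_comp S R).
Proof.
rewrite /rel_comp -(pushforward_range_within nuX k
  (c := prod_coding e (prod_coding d c)) (f := proj13 Z Y X))//.
rewrite /mxmul; congr inv_pushforward; apply: inv_fun_eq => -[z [y x]].
transitivity ((range_within k (prod_coding e d) S (z, y) : k) *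
  range_within k (prod_coding d c) R (y, x)); first by [].
rewrite !range_withinE asbool_natM; congr (nat_of_bool _)%:R.
apply/asbool_equiv_eq; split=> [[zy yx] t|H]; first by rewrite inE /= zy yx.
by split=> t; have := H t; rewrite inE => /andP[].
Qed.

(** * The nilpotent endomorphism *)

(** A relation without fixed points, all of whose products with itself and
    with the full relation are full. This takes at least three points. *)
Definition differ : {set 'I_3 * 'I_3} := [set p | p.1 != p.2]%SET.

Lemma differ_comp : [/\ rel_comp differ differ = [set: _]%SET,
  rel_comp differ [set: 'I_3 * 'I_3] = [set: _]%SET,
  rel_comp [set: 'I_3 * 'I_3] differ = [set: _]%SET &
  rel_comp [set: 'I_3 * 'I_3] [set: 'I_3 * 'I_3] = [set: 'I_3 * 'I_3]%SET].
Proof.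
have third (i j : 'I_3) : exists l : 'I_3, (i != l) && (l != j).
  have : (0 < #|~: [set i; j]%SET|)%N.
    by rewrite cardsCs finset.setCK card_ord cards2; case: (i != j).
  move=> /card_gt0P[l]; rewrite !inE negb_or => /andP[li lj].
  by exists l; rewrite eq_sym li.
split; apply/setP => -[i j]; rewrite [RHS]inE; apply/imsetP;
  have [l /andP[il lj]] := third i j; exists (i, (l, j)) => //=; rewrite !inE /= ?il ?lj//.
Qed.

Let Y3 := Y_fgset T 3.
Let c3 := Y_coding T 3.

(** The difference of two matrices e_R - e_F, R being the relation above and F
    the full one. Its entry at (y, x) is 0 if y and x differ everywhere, and
    -1 otherwise. *)
Definition nilp : mx k Y3 Y3 :=
  range_within k (prod_coding c3 c3) differ - range_within k (prod_coding c3 c3) [set: _]%SET.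

(** All four terms of the expansion are equal to e_F. *)
Lemma nilp_square : nilp *M nilp = 0.
Proof.
have [e1 e2 e3 e4] := differ_comp.
by rewrite /nilp mxmul_subl !mxmul_subr !mxmul_range_within e1 e2 e3 e4 !subrr.
Qed.

Lemma nilp_diag p : nilp (p, p) = -1.
Proof.
transitivity ((range_within k (prod_coding c3 c3) differ (p, p) : k) -
  range_within k (prod_coding c3 c3) [set: _]%SET (p, p)); first by [].
rewrite !range_withinE asbool_natF; last first.
  by have [t] := cantor_inhabited T => /(_ t); rewrite inE eqxx.
by rewrite asboolT ?sub0r// => t; rewrite inE.
Qed.

(** The trace integrates the diagonal entries, which are all -1, over Y(3),
    and Y(3) has measure 1: the indicator of the diagonal of Y(3) x Y(3) is
    e_U for U the diagonal of 'I_3 x 'I_3, and is pushed forward to a point. *)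
Lemma nilp_trace : @is_trace k (Perm k nu) Y3 nilp (-1).
Proof.
exists Y3, (diag_ev Y3), (diag_coev Y3); split; first exact: diag_dual.
pose B : mx k (Y3 ** Y3) (fgset1 T) := (diag_ev Y3 *M graph_mx k (gswap Y3 Y3)) *M
  kronecker nilp (graph_mx k (gmap_id Y3)).
have BE (y : Y3 ** Y3) : B (tt, y) = nilp (y.2, y.1).
  rewrite /B (@mxmul_single _ (Y3 ** Y3) _ _ _ _ _ (y.2, y.2)).
    by rewrite mxmul_graph /= !(asboolT (erefl _)) mul1r mulr1.
  move=> [p q] ne; rewrite mxmul_graph /=.
  have [qp|nqp] := pselect (q = p); last by rewrite asbool_natF ?mul0r.
  have [qy|nqy] := pselect (q = y.2); last by rewrite (asbool_natF nqy) !mulr0.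
  by case: ne; rewrite -qp qy.
pose c1 := unit_coding T.
pose U : {set unit * (('I_3 * 'I_3) * unit)} := [set t | t.2.1.1 == t.2.1.2]%SET.
pose h (t : unit * (('I_3 * 'I_3) * unit)) := (t.1, t.2.2).
have hU : h @: U = [set: _]%SET.
  apply/setP => -[[] []]; rewrite [RHS]inE; apply/imsetP.
  by exists (tt, ((ord0, ord0), tt)); rewrite ?inE.
change (B *M diag_coev Y3 = (-1 : k) *: (graph_mx k (gmap_id (fgset1 T)))).
transitivity (- range_within k (prod_coding c1 c1) (h @: U)).
  rewrite -(pushforward_range_within nuX k (c := prod_coding c1 (prod_coding (prod_coding c3 c3) c1))
    (f := proj13 (fgset1 T) (Y3 ** Y3) (fgset1 T)))//.
  rewrite -raddfN; congr inv_pushforward; apply: inv_fun_eq => -[[] [[p q] []]].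
  transitivity ((B (tt, (p, q)) : k) * (`[< p = q >])%:R); first by [].
  transitivity (- (range_within k (prod_coding c1 (prod_coding (prod_coding c3 c3) c1)) U
     (tt, ((p, q), tt)) : k)); last by [].
  rewrite range_withinE (BE (p, q) : _ = nilp (q, p)).
  have [<-|pq] := pselect (p = q).
    by rewrite nilp_diag !asboolT ?mulr1// => t; rewrite inE.
  rewrite (asbool_natF pq) mulr0 asbool_natF ?oppr0// => H; apply: pq.
  by apply: (code_inj (m := c3)) => t; have := H t; rewrite inE => /eqP.
rewrite hU; apply: inv_fun_eq => -[[] []].
transitivity (- (range_within k (prod_coding c1 c1) [set: _]%SET (tt, tt) : k)); first by [].
rewrite range_withinE asboolT => [|t]; last by rewrite inE.
change (- 1 = -1 * (`[< tt = tt >])%:R :> k).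
by rewrite asboolT// mulr1.
Qed.

Lemma nilp_nilpotent : @nilpotent_mor k (Perm k nu) Y3 nilp.
Proof.
exists 2; change (nilp *M (nilp *M graph_mx k (gmap_id Y3)) = 0).
have -> : nilp *M graph_mx k (gmap_id Y3) = nilp.
  by apply: inv_fun_eq => -[y x]; rewrite mxmul_graph.
exact: nilp_square.
Qed.

End Matrices.

Theorem mainTheorem6 (k : fieldType) (hk : [pchar k] =i pred0)
  (T : cantorSpace) (nu : gmeasure T rat) (nu_regular : regular_measure nu)
  (nuX : forall n : nat, (1 <= n)%N -> gmu_obj nu (X_fgset T n) = (-1) ^+ n.-1) :
  (exists f : mor (Vec k nu (Y_fgset T 3)) (Vec k nu (Y_fgset T 3)),
     nilpotent_mor f /\ exists2 t : k, is_trace f t & t <> 0) /\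
  (forall C : tensor_data k, pre_tannakian C ->
     ~ exists F : tensor_functor (Perm k nu) C, faithful_functor F).
Proof.
have nil := nilp_nilpotent k nuX; have tr := nilp_trace k nuX.
have neq0 : -1 <> 0 :> k by apply/eqP; rewrite oppr_eq0 oner_eq0.
split; first by exists (nilp k T); split=> //; exists (-1).
by move=> C ptC [F _]; exact: (no_functor_to_pre_tannakian nil tr neq0 ptC F).
Qed.
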